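(* Let $d$ and $a$ be integers with $d \geq 25$, $d$ odd and $|a| \geq 2^{164d}$. Then the equation \[ (x - ay)(x^2 + y^2)^{\frac{d-1}{2}} - y^d = x + y \] has at most $11$ solutions in integers $x$ and $y$. *)

(* Defs.v *)
From mathcomp Require Export all_boot all_order all_algebra.
From mathcomp Require Export classical_sets functions cardinality.

(* Main.v *)
Require Import Defs.
From mathcomp Require Import polyrcf realalg zify ring lra.

Import Order.TTheory GRing.Theory Num.Theory.
Local Open Scope ring_scope.

Set Implicit Arguments.
Unset Strict Implicit.

(** Write d = 2m + 1, N = |a| and f = (X - a)(X^2 + 1)^m - 1, which has a real
    root xi within 1 of a.  The solutions with y = 0 are (0,0), (1,0) and (-1,0), and
    those with x = ay satisfy y^(d-1) = -(a+1), so there are at most two of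
    them.  For any other solution x/y is so close to a that its reduced
    denominator q is at least N^(d-2), and |x/y - xi| <= 1/(2 q^(d-1)).  Two
    such fractions with q <= q' satisfy q' >= q^(d-2), so among four of them
    the third has denominator at least N^(529(d-2)).

    Four of them (up to sign) are then excluded by Thue's method applied to the
    last two, t and t'.  Siegel's lemma yields integer polynomials A, B of
    degree at most 3ds such that A - xi B vanishes to order 4s at xi; the
    Wronskian of A and B is nonzero because f is separable, and by Gauss's
    lemma it vanishes to small order at t.  Hence some low-order derivative of
    A - t' B does not vanish at t, and its size contradicts the trivial lower
    bound 1/(q^(3ds) q') when q^(4s) <= q' < q^(4s+4). *)

(** * Siegel's lemma and auxiliary polynomials *)

(** Pigeonhole on the vectors with entries in [0, E^2), where E = 2nQ + 1 and n = |I|: each of the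
    |J| forms takes values among at most E^3 integers, and E^(3|J|) < E^(2|I|). The solution is the
    difference of two vectors with the same values. *)
Lemma siegel_pigeonhole (I J : finType) (Q : nat) (c : I -> J -> int) :
    (0 < Q)%N -> (3 * #|J| < 2 * #|I|)%N ->
    (forall i j, `|c i j| <= Q%:Z) ->
  exists v : I -> int, [/\ exists i, v i != 0,
    forall i, `|v i| <= (((2 * #|I| * Q).+1) ^ 2)%N%:Z &
    forall j, \sum_i v i * c i j = 0].
Proof.
move=> Q0 cardIJ cQ; set n := #|I|; set E := (2 * n * Q).+1.
have n0 : (0 < n)%N by rewrite /n; lia.
have nQ0 : (0 < n * Q)%N by rewrite muln_gt0 n0.
have E1 : (1 < E)%N by rewrite /E; lia.
pose img (u : {ffun I -> 'I_(E ^ 2)}) j : int := \sum_i (u i)%:Z * c i j.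
pose off := (n * Q * (E ^ 2).-1)%N.
have bnd u j : `|img u j| <= off%:Z.
  apply: le_trans (ler_norm_sum _ _ _) _.
  apply: (@le_trans _ _ (\sum_(i : I) ((E ^ 2).-1 * Q)%N%:Z)); last first.
    by rewrite sumr_const -/n /off -mulnA mulnC pmulrn -mulrzl intz; lia.
  apply: ler_sum => i _; rewrite normrM PoszM.
  apply: ler_pM => //; have := ltn_ord (u i); lia.
(* Here 2 off + 1 = (E - 1)(E^2 - 1) + 1. *)
have offE : ((2 * off).+1 <= E ^ 3)%N.
  have : ((E ^ 2).-1.+1 = E ^ 2)%N by rewrite prednK // expn_gt0; lia.
  rewrite /off (expnS _ 2); move: ((E ^ 2).-1) (E ^ 2)%N => g e; rewrite /E; nia.
have E3 : ((E ^ 3).-1.+1 = E ^ 3)%N by rewrite prednK // expn_gt0; lia.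
(* The shift by [off] moves the values into [0, E^3), where [inord] is faithful and does not fall
   back on its default. *)
pose g (u : {ffun I -> 'I_(E ^ 2)}) : {ffun J -> 'I_((E ^ 3).-1.+1)} :=
  [ffun j => inord `|img u j + off%:Z|].
have [/injectiveP ginj|] := boolP (injectiveb g).
  have := leq_card _ ginj; rewrite !card_ffun !card_ord E3 -!expnM leq_exp2l //.
  by move/(leq_trans cardIJ); rewrite ltnn.
case/injectivePn => u [w neq_uw eq_g].
exists (fun i => (u i)%:Z - (w i)%:Z); split.
- apply/existsP; apply: contra_neqT neq_uw; rewrite negb_exists => /forallP h.
  apply/ffunP => i; apply/val_inj/eqP; move: (h i); rewrite negbK subr_eq0.
  by rewrite eqz_nat.
- move=> i; have := ltn_ord (u i); have := ltn_ord (w i); lia.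
- move=> j; have /ffunP/(_ j) := eq_g; rewrite !ffunE => /(congr1 val).
  have := bnd u j; have := bnd w j => bw bu.
  rewrite /= !inordK; [|lia|lia] => eq_abs.
  have : img u j = img w j by lia.
  move/eqP; rewrite -subr_eq0 => /eqP; rewrite /img -sumrB => eq0.
  by rewrite -[RHS]eq0; apply: eq_bigr => i _; rewrite mulrBl.
Qed.

Lemma bin_leq_exp2 n m : ('C(n, m) <= 2 ^ n)%N.
Proof.
elim: n m => [|n IH] [|m] //; first by rewrite bin0 expn_gt0.
by rewrite binS expnS mul2n -addnn leq_add.
Qed.

Lemma multiples_sum (R : comNzRingType) (I : finType) (F : I -> R) (f : R) :
  (forall i, exists S, F i = S * f) -> exists S, \sum_i F i = S * f.
Proof.
move=> hF; apply: (big_ind (fun x => exists S, x = S * f)) => //.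
- by exists 0; rewrite mul0r.
- by move=> _ _ [S ->] [S' ->]; exists (S + S'); rewrite mulrDl.
Qed.

Lemma coef_sum_scaleX (D : nat) (v : 'I_D -> int) l :
  (\sum_(i < D) v i *: 'X^i)`_l = if insub l is Some i then v i else 0.
Proof.
rewrite coef_sumMXn; case: insubP => [i _ <-|lD].
  by rewrite (big_pred1 i) // => x; rewrite /= -val_eqE.
by rewrite big_pred0 // => x; apply: contraNF lD => /eqP <-.
Qed.

(* The remainder of 'X^n modulo f when f is monic of positive degree. *)
Fixpoint Xn_mod (f : {poly int}) (n : nat) : {poly int} :=
  if n is n'.+1 then 'X * Xn_mod f n' - (Xn_mod f n')`_((size f).-2) *: f
  else 1.

Lemma Xn_modP (f : {poly int}) n : exists s, 'X^n = Xn_mod f n + s * f.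
Proof.
elim: n => [|n [s IH]] /=; first by exists 0; rewrite mul0r addr0 expr0.
exists (((Xn_mod f n)`_(size f).-2)%:P + 'X * s).
by rewrite exprS IH mulrDr -mul_polyC mulrDl !mulrA addrA subrK.
Qed.

(** Each step of the recursion subtracts from a shifted coefficient the product of one coefficient
    of the remainder and one of f, so the bound grows by a factor of at most T. *)
Lemma Xn_mod_bound (f : {poly int}) (T n : nat) : (forall i, 1 + `|f`_i| <= T%:Z) ->
  forall i, `|(Xn_mod f n)`_i| <= (T ^ n)%N%:Z.
Proof.
move=> fT; elim: n => [|n IH] i /=.
  by rewrite coef1 expn0; case: eqP.
rewrite coefB coefXM coefZ expnS PoszM.
apply: le_trans (ler_normB _ _) _.
have h : `|if i == 0 then 0 else (Xn_mod f n)`_i.-1| <= (T ^ n)%N%:Z.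
  by case: eqP.
apply: le_trans (lerD h _) _.
  rewrite normrM; apply: ler_wpM2r (IH _); exact: normr_ge0.
have := fT i; set u := `|f`_i|; nia.
Qed.

Section Reduction.
Variables (f : {poly int}) (d : nat).
Hypotheses (f_monic : f \is monic) (size_f : size f = d.+1) (d_gt0 : (0 < d)%N).

Lemma size_Xn_mod n : (size (Xn_mod f n) <= d)%N.
Proof using f_monic size_f d_gt0.
elim: n => [|n IH] /=; first by rewrite size_poly1.
apply/leq_sizeP => j dj; rewrite coefB coefXM coefZ size_f /=.
have fd : f`_d = 1 by move/monicP: f_monic; rewrite lead_coefE size_f.
case: j dj => [|j] dj; first by lia.
move: dj; rewrite leq_eqVlt => /predU1P[<-|dj]; last first.
  rewrite [f`_ _]nth_default ?size_f // mulr0 subr0 nth_default //=.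
  exact: leq_trans IH dj.
by rewrite fd mulr1 eqn0Ngt d_gt0 subrr.
Qed.

(** At a root xi of f the last condition makes A - xi B vanish to order k; divisibility by f
    expresses this over the integers. Reduction of monomials modulo f turns it into kd linear
    equations in the 2D coefficients of A and B, and Siegel's lemma applies because 3kd < 2(2D). *)
Lemma auxiliary_pair (T k D : nat) : (0 < T)%N ->
    (3 * (k * d) < 4 * D)%N -> (forall i, 1 + `|f`_i| <= T%:Z) ->
  exists A B : {poly int}, let h := ((4 * D * (2 ^ D * T ^ D)).+1 ^ 2)%N%:Z in
  [/\ (A != 0) || (B != 0), (size A <= D)%N /\ (size B <= D)%N,
      forall i, `|A`_i| <= h, forall i, `|B`_i| <= h &
      forall j, (j < k)%N -> exists S, A^`N(j) - 'X * B^`N(j) = S * f].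
Proof using f_monic size_f d_gt0.
move=> T0 kD fT.
(* The boolean is false for A and true for B, where the factor -X changes the sign and raises the
   exponent by one. The truncation in [i - j] is harmless, as the binomial coefficient vanishes for
   i < j. *)
pose sg (b : bool) : int := if b then -1 else 1.
pose r (b : bool) (i j : nat) := Xn_mod f (i - j + b)%N.
pose c (x : bool * 'I_D) (y : 'I_k * 'I_d) : int :=
  sg x.1 * ((r x.1 x.2 y.1)`_y.2 *+ 'C(x.2, y.1)).
have cQ x y : `|c x y| <= (2 ^ D * T ^ D)%N%:Z.
  case: x y => b i [j l] /=; rewrite /c /= normrM normrMn.
  have -> : `|sg b| = 1 by case: b.
  rewrite mul1r -mulr_natl natz PoszM.
  case: (ltnP i j) => ij; first by rewrite bin_small // mul0r.
  apply: ler_pM => //.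
    rewrite lez_nat; apply: leq_trans (leq_pexp2l _ (ltnW (ltn_ord i))) => //.
    exact: bin_leq_exp2.
  apply: le_trans (Xn_mod_bound _ fT _) _; rewrite lez_nat.
  by apply: leq_pexp2l => //; have := ltn_ord i; case: b => /=; lia.
have [||v [[[b0 i0] v0] vh vc]] := siegel_pigeonhole _ _ cQ.
- by rewrite muln_gt0 !expn_gt0 T0.
- by rewrite !card_prod !card_ord card_bool; lia.
rewrite card_prod card_ord card_bool (mulnA 2 2 D) in vh.
pose P b := \sum_(i < D) v (b, i) *: 'X^i.
have size_P b : (size (P b) <= D)%N.
  apply/leq_sizeP => l Dl; rewrite coef_sum_scaleX insubN // -leqNgt //.
have coef_P b l : `|(P b)`_l| <= ((4 * D * (2 ^ D * T ^ D)).+1 ^ 2)%N%:Z.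
  by rewrite coef_sum_scaleX; case: insubP => [i _ _|_] //; exact: vh.
exists (P false), (P true) => h; split => //.
  have : P b0 != 0.
    apply: contraNneq v0 => P0; have := coef_sum_scaleX (fun i => v (b0, i)) i0.
    by rewrite -/(P b0) P0 coef0 valK => <-.
  by case: b0 {v0} => ->; rewrite ?orbT.
move=> j jk.
(* [e] is the part of a monomial divisible by f; the remainders [r] cancel by the choice of [v]. *)
pose e (x : bool * 'I_D) := 'X^(x.2 - j + x.1)%N - r x.1 x.2 j.
pose w (x : bool * 'I_D) : int := v x * sg x.1 * ('C(x.2, j))%:Z.
have -> : (P false)^`N(j) - 'X * (P true)^`N(j)
    = \sum_x w x *: r x.1 x.2 j + \sum_x w x *: e x.
  rewrite -big_split /=.
  have -> : \sum_x (w x *: r x.1 x.2 j + w x *: e x)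
      = \sum_x w (x.1, x.2) *: 'X^(x.2 - j + x.1)%N.
    by apply: eq_bigr => -[b i] _ /=; rewrite -scalerDr addrC subrK.
  rewrite -(pair_bigA _ (fun b i => w (b, i) *: 'X^(i - j + b)%N)) /= big_bool.
  rewrite /P !linear_sum /= mulr_sumr addrC -sumrN; congr (_ + _).
    apply: eq_bigr => i _; rewrite nderivnZ nderivnXn /w /sg /= mulr1 addn0.
    by rewrite -scaler_nat natz scalerA.
  apply: eq_bigr => i _; rewrite nderivnZ nderivnXn /w /sg /= mulrN1 addn1.
  rewrite exprS mulNr scaleNr -scaler_nat natz scalerA; congr (- _).
  by rewrite scalerAr.
have -> : \sum_x w x *: r x.1 x.2 j = 0.
  apply/polyP => l; rewrite coef0 coef_sum.
  case: (ltnP l d) => ld; last first.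
    rewrite big1 // => x _; rewrite coefZ nth_default ?mulr0 //.
    exact: leq_trans (size_Xn_mod _) ld.
  rewrite -[RHS](vc (Ordinal jk, Ordinal ld)); apply: eq_bigr => x _.
  by rewrite coefZ /c /w /= -mulr_natl natz; ring.
rewrite add0r; apply: multiples_sum => x.
have [s Es] := Xn_modP f (x.2 - j + x.1)%N.
by exists (w x *: s); rewrite /e Es /r addrC addKr scalerAl.
Qed.
End Reduction.

(** * Wronskians and orders of vanishing *)

(** Induction on k: if G = C f^(k+1) and f^(k+2) is wanted, then f^(k+1) divides G', hence f divides
    (k+1) C f', and so C, by separability in characteristic zero. *)
Lemma dvdp_exp_derivn (F : numFieldType) (f G : {poly F}) k :
  f != 0 -> coprimep f f^`() -> (forall j, (j < k)%N -> f %| G^`(j)) ->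
  f ^+ k %| G.
Proof.
move=> f0 cop; elim: k G => [|k IH] G fG; first by rewrite expr0 dvd1p.
case: k IH fG => [|k] IH fG; first by rewrite expr1; have := fG 0%N isT.
have /dvdpP[C EC] : f ^+ k.+1 %| G by apply: IH => j jk; apply: fG; rewrite ltnW.
have : f ^+ k.+1 %| G^`() by apply: IH => j jk; rewrite -derivSn; apply: fG.
rewrite EC derivM deriv_exp /= addrC dvdp_addl ?dvdp_mulIr //.
have -> : C * (f^`() * f ^+ k *+ k.+1) = k.+1%:R *: (C * f^`()) * f ^+ k.
  by rewrite scaler_nat mulrnAr mulrnAl mulrA.
rewrite exprS dvdp_mul2r ?expf_neq0 // dvdpZr ?pnatr_eq0 // Gauss_dvdpl // => fC.
by rewrite -?exprS (exprS _ k.+1) dvdp_mul.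
Qed.

Lemma deriv_eq0_size (F : numFieldType) (p : {poly F}) :
  p^`() = 0 -> (size p <= 1)%N.
Proof.
move=> p0; apply/leq_sizeP => -[|j] // _.
have := coef_deriv p j; rewrite p0 coef0 => /esym/eqP.
by rewrite mulrn_eq0 => /= /eqP.
Qed.

Lemma dvdp_deriv_size (F : numFieldType) (p : {poly F}) :
  p %| p^`() -> (size p <= 1)%N.
Proof.
move=> pp; have [/deriv_eq0_size //|p0] := eqVneq p^`() 0.
have p'0 : p != 0 by apply: contraNneq p0 => ->; rewrite linear0.
by have := leq_trans (lt_size_deriv p'0) (dvdp_leq p0 pp); rewrite ltnn.
Qed.

(** After division by the gcd, coprime a and b satisfy a b' = a' b. Then a divides a' and b divides
    b', so both are constant by degree. *)
Lemma wronskian_eq0_proportional (F : numFieldType) (A B : {poly F}) :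
  (A != 0) || (B != 0) -> A * B^`() = A^`() * B ->
  exists G a b, [/\ G != 0, (a != 0) || (b != 0), A = a *: G & B = b *: G].
Proof.
move=> AB0 W0; pose G := gcdp A B.
have G0 : G != 0 by rewrite gcdp_eq0 negb_and.
pose a := A %/ G; pose b := B %/ G.
have EA : A = a * G by rewrite divpK ?dvdp_gcdl.
have EB : B = b * G by rewrite divpK ?dvdp_gcdr.
have cab : coprimep a b by rewrite coprimep_div_gcd.
have {W0} W0 : a * b^`() = a^`() * b.
  apply: (mulIf (mulf_neq0 G0 G0)); move: W0; rewrite EA EB !derivM => W0.
  apply/eqP; rewrite -subr_eq0; apply/eqP.
  transitivity (a * G * (b^`() * G + b * G^`()) - (a^`() * G + a * G^`()) * (b * G));
    first by ring.
  by rewrite W0 subrr.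
have sb : (size b <= 1)%N.
  apply: dvdp_deriv_size; have : b %| a * b^`() by rewrite W0 dvdp_mulIr.
  by rewrite Gauss_dvdpr // coprimep_sym.
have sa : (size a <= 1)%N.
  apply: dvdp_deriv_size; have : a %| a^`() * b by rewrite -W0 dvdp_mulIl.
  by rewrite Gauss_dvdpl.
exists G, a`_0, b`_0; rewrite -!mul_polyC -(size1_polyC sa) -(size1_polyC sb).
split => //.
rewrite -(polyC_eq0 a`_0) -(polyC_eq0 b`_0) -(size1_polyC sa) -(size1_polyC sb).
by move: AB0; rewrite EA EB !mulf_eq0 (negPf G0) !orbF.
Qed.

(** Otherwise A = aG and B = bG with constants a, b, and f divides (a - bX) G^(j) for all j < k.
    Having no root in the field, f is coprime to a - bX, so f^k divides G, whose degree is less than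
    dk. *)
Lemma auxiliary_wronskian_neq0 (F : numFieldType) (f A B : {poly F}) (d k D : nat) :
  size f = d.+1 -> coprimep f f^`() -> (forall c, ~~ root f c) ->
  (A != 0) || (B != 0) -> (size A <= D)%N -> (size B <= D)%N ->
  (D <= d * k)%N ->
  (forall j, (j < k)%N -> f %| A^`N(j) - 'X * B^`N(j)) ->
  A * B^`() - A^`() * B != 0.
Proof.
move=> sf cop nroot AB0 sA sB Dk fAB; rewrite subr_eq0.
apply/eqP => /(wronskian_eq0_proportional AB0)[G [a [b [G0 ab0 EA EB]]]].
have f0 : f != 0 by rewrite -size_poly_eq0 sf.
have sG : (size G <= D)%N.
  case/orP: ab0 => c0; first by rewrite -(size_scale G c0) -EA.
  by rewrite -(size_scale G c0) -EB.
have : f ^+ k %| G.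
  apply: dvdp_exp_derivn => // j jk; rewrite nderivn_def -mulr_natr dvdp_mulr //.
  have := fAB j jk; rewrite EA EB !linearZ /= -scalerAr scalerAl -mul_polyC -mulrBl.
  rewrite Gauss_dvdpr //; have [b0|b0] := eqVneq b 0.
    rewrite b0 scale0r subr0; move: ab0; rewrite b0 eqxx orbF => a0.
    by rewrite -alg_polyC coprimepZr // coprimep1.
  have -> : a%:P - b *: 'X = (- b) *: ('X - (a / b)%:P).
    rewrite scalerBr scaleNr addrC; congr (_ + _).
    by rewrite -mul_polyC -polyCM mulNr mulrC divfK // polyCN opprK.
  by rewrite coprimepZr ?oppr_eq0 // coprimep_XsubC.
move/(dvdp_leq G0)/leq_trans/(_ sG).
have fk0 : (0 < size (f ^+ k))%N by rewrite size_poly_gt0 expf_neq0.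
by rewrite -(prednK fk0) size_exp sf /=; lia.
Qed.

(** Gauss's lemma: for t = p/q in lowest terms, qX - p is primitive, so its J-th power divides w
    over the integers, and its leading coefficient is q^J. *)
Lemma denq_exp_dvd_lead (w : {poly int}) (t : rat) J :
  ('X - t%:P) ^+ J %| map_poly intr w -> (denq t ^+ J %| lead_coef w)%Z.
Proof.
pose g : {poly int} := denq t *: 'X - (numq t)%:P.
have Eg : map_poly intr g = (denq t)%:~R *: ('X - t%:P) :> {poly rat}.
  rewrite rmorphB /= map_polyZ map_polyX map_polyC /= scalerBr; congr (_ - _).
  by rewrite numqE -mul_polyC -polyCM mulrC.
have d0 : (denq t)%:~R != 0 :> rat by rewrite intr_eq0 denq_eq0.
rewrite -(dvdpZl _ _ (expf_neq0 J d0)) -exprZn -Eg -rmorphXn /= dvdp_rat_int.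
move/dvdpP_int => [r ->].
have g1 : g`_1 = denq t by rewrite coefB coefZ coefX coefC mulr1 subr0.
have g0 : g`_0 = - numq t by rewrite coefB coefZ coefX coefC mulr0 sub0r.
have sg : size g = 2.
  apply/eqP; rewrite eqn_leq; apply/andP; split; last first.
    by rewrite ltnNge; apply/negP => /leq_sizeP/(_ 1%N isT)/eqP; rewrite g1 denq_eq0.
  apply/leq_sizeP => -[|[|j]] // _.
  by rewrite coefB coefZ coefX coefC mulr0 subr0.
have lg : lead_coef g = denq t by rewrite lead_coefE sg.
have c1 : `|zcontents g|%N = 1%N.
  have : (zcontents g %| zcontents g)%Z by rewrite dvdzz.
  rewrite dvdz_contents => /polyOverP gz.
  have h0 := gz 0%N; have h1 := gz 1%N; move: h0 h1; rewrite g0 g1 !dvdzE abszN => h0 h1.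
  have := coprime_num_den t; rewrite /coprime => /eqP gcd1.
  by apply/eqP; rewrite -dvdn1 -gcd1 dvdn_gcd h0 h1.
have lz : `|lead_coef (zprimitive g)|%N = `|denq t|%N.
  by rewrite -lg {2}[g]zpolyEprim lead_coefZ abszM c1 mul1n.
have -> : zprimitive (g ^+ J) = zprimitive g ^+ J.
  elim: J => [|J IH]; last by rewrite !exprS zprimitiveM IH.
  by rewrite !expr0 zprimitive_monic // monic1.
by rewrite lead_coefM dvdz_mulr // dvdzE lead_coef_exp !abszX lz.
Qed.

(** * Size estimates *)

Lemma nderivn_nderivn_root (R : numDomainType) (p : {poly R}) x i j :
  p^`N(i + j).[x] = 0 -> p^`N(j)^`N(i).[x] = 0.
Proof.
move=> pij; apply/eqP.
have : p^`N(j)^`N(i).[x] *+ i`! *+ j`! == 0.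
  rewrite -!hornerMn -nderivn_def -derivnMn -nderivn_def /derivn -iterD.
  by rewrite -/(derivn (i + j) p) nderivn_def hornerMn pij mul0rn.
by rewrite !mulrn_eq0 !eqn0Ngt !fact_gt0.
Qed.

Lemma size_nderivn_leq (R : nzSemiRingType) (D : nat) (p : {poly R}) j :
  (size p <= D)%N -> (size p^`N(j) <= D)%N.
Proof.
move=> sp; apply/leq_sizeP => i Di; rewrite coef_nderivn nth_default ?mul0rn //.
by apply: leq_trans sp (leq_trans Di (leq_addl _ _)).
Qed.

Section Bounds.
Variables (R : realFieldType) (D : nat).

Lemma horner_bound (p : {poly R}) (h T x : R) :
  (size p <= D)%N -> (forall i, `|p`_i| <= h) -> 1 <= T -> `|x| <= T ->
  `|p.[x]| <= D%:R * h * T ^+ D.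
Proof using.
move=> sp ph T1 xT; rewrite (horner_coef_wide x sp).
apply: le_trans (ler_norm_sum _ _ _) _.
have -> : D%:R * h * T ^+ D = \sum_(i < D) (h * T ^+ D).
  by rewrite sumr_const card_ord -[RHS]mulr_natl mulrA.
apply: ler_sum => i _; rewrite normrM normrX ler_pM ?exprn_ge0 //.
have xTi : `|x| ^+ i <= T ^+ i.
  by apply: lerXn2r => //; rewrite nnegrE ?normr_ge0 // (le_trans ler01 T1).
apply: le_trans xTi _; apply: ler_weXn2l => //; exact: ltnW (ltn_ord i).
Qed.

Lemma coef_nderivn_bound (p : {poly R}) (h : R) j :
  (size p <= D)%N -> (forall i, `|p`_i| <= h) ->
  forall i, `|p^`N(j)`_i| <= h * 2 ^+ D.
Proof using.
move=> sp ph i; have h0 : 0 <= h by exact: le_trans (normr_ge0 _) (ph 0%N).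
rewrite coef_nderivn; case: (ltnP (j + i) D) => ji; last first.
  rewrite nth_default ?mul0rn ?normr0 ?mulr_ge0 ?exprn_ge0 //.
  exact: leq_trans sp ji.
rewrite normrMn -[leLHS]mulr_natr ler_pM //.
rewrite -natrX ler_nat; apply: leq_trans (bin_leq_exp2 _ _) _.
by rewrite leq_exp2l // ltnW.
Qed.

(** In the Taylor expansion of the j-th derivative at xi the terms of index below k - j vanish. One
    factor D counts the Taylor terms, the other the monomials; the two powers of 2 come from the two
    successive derivatives. *)
Lemma taylor_vanishing_bound (G : {poly R}) (h T xi t : R) (k j : nat) :
  (size G <= D)%N -> (forall i, `|G`_i| <= h) -> 1 <= T -> `|xi| <= T ->
  `|t - xi| <= 1 -> (forall i, (i < k)%N -> G^`N(i).[xi] = 0) ->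
  `|G^`N(j).[t]| <= `|t - xi| ^+ (k - j) *
                    (D%:R * (D%:R * (h * 2 ^+ D * 2 ^+ D) * T ^+ D)).
Proof using.
move=> sG Gh T1 xT txi Gk; set M := D%:R * (_ * _) * _.
have sGj := size_nderivn_leq j sG.
have Gjh := coef_nderivn_bound j sG Gh.
have Mb i : `|G^`N(j)^`N(i).[xi]| <= M.
  apply: horner_bound => //; first exact: size_nderivn_leq.
  exact: coef_nderivn_bound.
have -> : t = xi + (t - xi) by rewrite addrC subrK.
rewrite (nderiv_taylor_wide _ sGj); last exact: mulrC.
rewrite [xi + _ - _]addrC addKr.
apply: le_trans (ler_norm_sum _ _ _) _.
have -> : `|t - xi| ^+ (k - j) * (D%:R * M) = \sum_(i < D) (M * `|t - xi| ^+ (k - j)).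
  by rewrite sumr_const card_ord -[RHS]mulr_natl mulrCA [M * _]mulrC.
apply: ler_sum => i _; rewrite normrM normrX.
case: (ltnP i (k - j)) => ikj.
  rewrite nderivn_nderivn_root; last by apply: Gk; lia.
  rewrite normr0 mul0r mulr_ge0 ?exprn_ge0 //.
  exact: le_trans (normr_ge0 _) (Mb 0%N).
by apply: ler_pM; rewrite ?exprn_ge0 // ler_wiXn2l.
Qed.
End Bounds.

Lemma horner_denq_int (P : {poly int}) (t : rat) D : (size P <= D.+1)%N ->
  exists n : int, (map_poly intr P).[t] * (denq t)%:~R ^+ D = n%:~R.
Proof.
move=> sP; exists (\sum_(i < D.+1) P`_i * (numq t ^+ i * denq t ^+ (D - i))).
rewrite (@horner_coef_wide _ D.+1) ?size_map_inj_poly //; last exact: intr_inj.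
rewrite mulr_suml rmorph_sum /=; apply: eq_bigr => i _.
rewrite coef_map /= !rmorphM !rmorphXn /= numqE exprMn -!mulrA; congr (_ * (_ * _)).
by rewrite -exprD subnKC // -ltnS.
Qed.

Lemma lead_coef_wronskian_bound (A B : {poly int}) (D h : nat) : (0 < D)%N ->
  (size A <= D)%N -> (size B <= D)%N ->
  (forall i, `|A`_i| <= h%:Z) -> (forall i, `|B`_i| <= h%:Z) ->
  `|lead_coef (A * B^`() - A^`() * B)| <= (4 * D ^ 2 * h ^ 2)%N%:Z.
Proof.
move=> D0 sA sB Ah Bh.
have ds (p : {poly int}) : (size p <= D)%N -> (size p^`() <= D)%N.
  move=> sp; apply/leq_sizeP => i Di; rewrite coef_deriv nth_default ?mul0rn //.
  exact: leq_trans sp (leqW Di).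
have dh (p : {poly int}) : (size p <= D)%N -> (forall i, `|p`_i| <= h%:Z) ->
    forall i, `|p^`()`_i| <= (h * D)%N%:Z.
  move=> sp ph i; rewrite coef_deriv; case: (ltnP i.+1 D) => iD; last first.
    by rewrite nth_default ?mul0rn // (leq_trans sp).
  rewrite normrMn -mulr_natr natz PoszM ler_pM // lez_nat; exact: ltnW.
have prod (p q : {poly int}) u v n : (n < 2 * D)%N -> (forall i, `|p`_i| <= u%:Z) ->
    (forall i, `|q`_i| <= v%:Z) -> `|(p * q)`_n| <= (2 * D * (u * v))%N%:Z.
  move=> nD pu qv; rewrite coefM; apply: le_trans (ler_norm_sum _ _ _) _.
  apply: (@le_trans _ _ (\sum_(i < n.+1) (u * v)%N%:Z)).
    by apply: ler_sum => i _; rewrite normrM PoszM ler_pM.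
  by rewrite sumr_const card_ord -mulr_natl natz -PoszM lez_nat leq_mul2r nD orbT.
rewrite lead_coefE; set W := _ - _.
have [W0|W0] := eqVneq (size W) 0%N; first by rewrite nth_default // W0.
have sW : ((size W).-1 < 2 * D)%N.
  rewrite prednK ?lt0n //; apply: leq_trans (size_polyD _ _) _.
  rewrite size_polyN geq_max; apply/andP; split; apply: leq_trans (size_polyMleq _ _) _.
    by apply: leq_trans (leq_pred _) _; rewrite mul2n -addnn leq_add // ds.
  by apply: leq_trans (leq_pred _) _; rewrite mul2n -addnn leq_add // ds.
rewrite coefB; apply: le_trans (ler_normB _ _) _.
apply: le_trans (lerD (prod _ _ _ _ _ sW Ah (dh _ sB Bh)) (prod _ _ _ _ _ sW (dh _ sA Ah) Bh)) _.
by rewrite -PoszD lez_nat; apply: eq_leq; ring.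
Qed.

(** Such a j is the order of vanishing of P at t. *)
Lemma first_nonvanishing_nderivn (F : numFieldType) (P : {poly F}) (t : F) :
  P != 0 -> exists j, P^`N(j).[t] != 0 /\ ('X - t%:P) ^+ j %| P.
Proof.
move=> P0.
have key j : (forall i, (i < j)%N -> P^`N(i).[t] = 0) -> ('X - t%:P) ^+ j %| P.
  move=> Pj; apply: dvdp_exp_derivn; rewrite ?polyXsubC_eq0 //.
    by rewrite derivXsubC coprimep1.
  by move=> i ij; rewrite dvdp_XsubCl /root nderivn_def hornerMn Pj // mul0rn.
have [j Pj] : exists j, P^`N(j).[t] != 0.
  have [j Pj|nP] := pickP (fun j : 'I_(size P) => P^`N(j).[t] != 0).
    by exists j.
  have /(dvdp_leq P0) : ('X - t%:P) ^+ (size P) %| P.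
    apply: key => i iP; have := nP (Ordinal iP) => /=.
    by move/negbFE/eqP.
  by rewrite size_exp_XsubC ltnn.
have exj : exists j, P^`N(j).[t] != 0 by exists j.
case: (ex_minnP exj) => i Pi imin; exists i; split=> //; apply: key => l li.
apply/eqP; apply: contraTT li => /imin; by rewrite -leqNgt.
Qed.

(** * Numerical bounds for Thue's method *)

Section SizeBounds.
Local Open Scope nat_scope.
Variables (T D : nat).
Hypotheses (T_ge : 2 ^ 8 <= T) (D_gt0 : 0 < D).

Let w := 2 ^ D.
Let tau := T ^ D.

Let w_ge2 : 2 <= w. Proof. by rewrite -{1}(expn1 2) leq_exp2l. Qed.
Let D_le_w : D <= w. Proof. by rewrite ltnW // ltn_expl. Qed.
(** This is the purpose of T >= 2^8: a single factor [tau] absorbs up to eight factors [w], and with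
    them the factors D and the small constants. *)
Let w8 : w ^ 8 <= tau.
Proof. by rewrite /w -expnM mulnC expnM leq_exp2r. Qed.

Let wtau n : n <= 8 -> w ^ n <= tau.
Proof.
move=> n8; apply: leq_trans w8; apply: leq_pexp2l n8.
by apply: leq_trans w_ge2.
Qed.

Let T_le_tau : T <= tau.
Proof.
rewrite -{1}(expn1 T); apply: leq_pexp2l D_gt0; exact: leq_trans T_ge.
Qed.

Lemma siegel_bound : (4 * D * (2 ^ D * T ^ D)).+1 ^ 2 <= tau ^ 4.
Proof using T_ge D_gt0.
rewrite (expnM _ 2 2) leq_exp2r // -/w -/tau.
apply: (@leq_trans (w ^ 5 * tau)); last by rewrite -mulnn leq_mul2r wtau ?orbT.
have tau0 : 0 < tau by apply: leq_trans T_le_tau; apply: leq_trans T_ge.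
apply: (@leq_trans (8 * D * (w * tau))).
  have : 0 < D * (w * tau) by rewrite !muln_gt0 D_gt0 tau0 (leq_trans _ w_ge2).
  rewrite -!mulnA; lia.
have -> : w ^ 5 * tau = w ^ 3 * w * (w * tau) by rewrite !expnS expn0; ring.
apply: leq_mul => //; apply: leq_mul => //.
by apply: (@leq_trans (2 ^ 3)) => //; rewrite leq_exp2r.
Qed.

Lemma taylor_bound h : h <= tau ^ 4 ->
  2 * (D * (D * (h * T * 2 ^ D * 2 ^ D) * T ^ D)) <= tau ^ 7.
Proof using T_ge D_gt0.
move=> hb; rewrite -/w -/tau.
apply: (@leq_trans (w * (w * (w * (tau ^ 4 * tau * w * w) * tau)))).
  by do !apply: leq_mul => //.
have -> : w * (w * (w * (tau ^ 4 * tau * w * w) * tau)) = w ^ 5 * tau ^ 6.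
  by rewrite !expnS expn0; ring.
by rewrite (expnS tau 6) leq_mul2r wtau ?orbT.
Qed.

Lemma wronskian_bound h : h <= tau ^ 4 -> 4 * D ^ 2 * h ^ 2 <= tau ^ 9.
Proof using T_ge D_gt0.
move=> hb; apply: (@leq_trans (w ^ 2 * w ^ 2 * (tau ^ 4) ^ 2)).
  apply: leq_mul; last by rewrite leq_exp2r.
  by apply: leq_mul; [rewrite (_ : 4 = 2 ^ 2) // leq_exp2r | rewrite leq_exp2r].
by rewrite -expnD -expnM (expnS tau 8) leq_mul2r wtau ?orbT.
Qed.
End SizeBounds.

Section Exponents.
Local Open Scope nat_scope.
Variables (d s : nat).
Hypotheses (d25 : 25 <= d) (s5 : 5 <= s).

Lemma exponent_degree : (3 * d * s).+1 <= d * (4 * s).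
Proof using d25 s5. by have : 0 < d * s; nia. Qed.

(** With T^(160d) <= q this gives T^(Dc) <= q^s for D = 3ds + 1. It is needed for c = 36, the fourth
    power of the Wronskian bound T^(9D), and for c = 7, the Taylor bound. *)
Lemma exponent_size c : c <= 36 -> (3 * d * s).+1 * c <= 160 * d * s.
Proof using d25 s5.
move=> c36; apply: (@leq_trans (4 * (d * s) * 36)); last by lia.
by apply: leq_mul => //; have : 0 < d * s by [rewrite muln_gt0; lia]; lia.
Qed.

(** On the left, 3ds comes from clearing the denominator of t, 4(s+1) from q' < q^(4s+4), and s from
    the Taylor constant; on the right is the gain from the vanishing at xi. *)
Lemma exponent_first j : 4 * j.-1 <= s ->
  3 * d * s + 4 * s.+1 + s <= d.-1 * (4 * s - j).
Proof using d25 s5.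
move=> js; have : 15 * s <= 4 * (4 * s - j) + 4 by lia.
move: (4 * s - j) => k hk; have [e ->] : exists e, d = e + 25 by exists (d - 25); lia.
have -> : (e + 25).-1 = e + 24 by lia.
nia.
Qed.

Lemma exponent_second : 3 * d * s + s < 4 * s * (d - 2).
Proof using d25 s5.
have [e ->] : exists e, d = e + 25 by exists (d - 25); lia.
have -> : e + 25 - 2 = e + 23 by lia.
nia.
Qed.
End Exponents.

(** * Thue's method for two approximations *)

Lemma ratr_horner_int (R : numFieldType) (P : {poly int}) (t : rat) :
  ratr (map_poly intr P).[t] = (map_poly intr P).[ratr t] :> R.
Proof.
rewrite -horner_map; congr (_.[_]); apply/polyP => i.
by rewrite !coef_map /= ratr_int.
Qed.

Lemma thue_pair (R : realFieldType) (f : {poly int}) (d T : nat) (xi : R)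
    (t t' : rat) (q := `|denq t|%N) (q' := `|denq t'|%N) :
  f \is monic -> size f = d.+1 -> (25 <= d)%N -> (2 ^ 8 <= T)%N ->
  (forall i, 1 + `|f`_i| <= T%:Z) ->
  coprimep (map_poly intr f : {poly rat}) (map_poly intr f)^`() ->
  (forall c : rat, ~~ root (map_poly intr f) c) ->
  (map_poly intr f).[xi] = 0 -> 1 + `|xi| <= T%:R ->
  `|ratr t - xi| <= (q ^ d.-1)%:R^-1 -> `|ratr t' - xi| <= (q' ^ d.-1)%:R^-1 ->
  (T ^ (160 * d) <= q)%N -> (q ^ 23 <= q')%N -> False.
Proof.
move=> f_monic sf d25 T8 fT cop nroot fxi xiT t_xi t'_xi qT qq'.
have q_gt1 : (1 < q)%N.
  apply: leq_trans qT; apply: (@leq_trans (T ^ 1)).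
    by rewrite expn1; apply: leq_trans T8.
  by apply: leq_pexp2l; [apply: leq_trans T8 | lia].
have q_gt0 : (0 < q)%N by apply: ltnW.
have q'_gt0 : (0 < q')%N by rewrite /q' absz_gt0 denq_eq0.
(* Thus q^(4s) <= q' < q^(4s+4), and q^23 <= q' forces s >= 5. *)
pose s := trunc_log (q ^ 4) q'.
have q4 : (1 < q ^ 4)%N by rewrite -(exp1n 4) ltn_exp2r.
have /andP[] := trunc_log_bounds q4 q'_gt0; rewrite -/s -!expnM => sq' q's.
have s5 : (5 <= s)%N.
  have := leq_ltn_trans qq' q's; rewrite ltn_exp2l //; lia.
(* The condition 3(4s)d < 4D of [auxiliary_pair] dictates this size. *)
pose D := (3 * d * s).+1.
have [|||A [B [AB0 [sA sB] Ah Bh AB]]] :=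
  @auxiliary_pair f d f_monic sf _ T (4 * s) D _ _ fT; rewrite /D; try lia.
rewrite -/D in Ah Bh sA sB.
move: Ah Bh; set h := (_ ^ 2)%N => Ah Bh.
have hb : (h <= (T ^ D) ^ 4)%N by apply: siegel_bound.
pose toQ := map_poly intr : {poly int} -> {poly rat}.
pose W := A * B^`() - A^`() * B.
have toQ_eq0 (p : {poly int}) : (toQ p == 0) = (p == 0).
  by rewrite -!size_poly_eq0 size_map_inj_poly //; exact: intr_inj.
have W0 : W != 0.
  rewrite -toQ_eq0 /W /toQ rmorphB !rmorphM /= -!deriv_map.
  apply: (@auxiliary_wronskian_neq0 _ (toQ f) _ _ d (4 * s) D) => //.
  - by rewrite size_map_inj_poly //; exact: intr_inj.
  - by rewrite !toQ_eq0.
  - by rewrite size_map_inj_poly //; exact: intr_inj.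
  - by rewrite size_map_inj_poly //; exact: intr_inj.
  - exact: exponent_degree.
  - move=> j /AB[S ES].
    rewrite !nderivn_map -(map_polyX intr) -rmorphM -rmorphB /= ES rmorphM /=.
    exact: dvdp_mulIr.
pose P := toQ A - t' *: toQ B.
(* Subtracting a constant multiple of B from A does not change the Wronskian with B. *)
have EW : toQ W = P * (toQ B)^`() - P^`() * toQ B.
  rewrite /P derivB derivZ /W /toQ rmorphB !rmorphM /= -!deriv_map !mulrBl.
  by rewrite -!scalerAl [(map_poly _ B) * _]mulrC; ring.
have P0 : P != 0.
  apply: contra_neq W0 => EP; apply/eqP; rewrite -toQ_eq0 EW EP.
  by rewrite linear0 !mul0r subrr.
have [j [Pj jP]] := first_nonvanishing_nderivn t P0.
(* P vanishes to order j at t, hence W to order at least j - 1. So q^(j-1) divides the leading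
   coefficient of W, and the fourth power of the bound for that coefficient is at most q^s. *)
have j_small : (4 * j.-1 <= s)%N.
  have dvdW : (denq t ^+ j.-1 %| lead_coef W)%Z.
    apply: denq_exp_dvd_lead; rewrite -/(toQ W) EW.
    have dP : ('X - t%:P) ^+ j.-1 %| P.
      by apply: dvdp_trans jP; rewrite dvdp_exp2l // leq_pred.
    have dP' : ('X - t%:P) ^+ j.-1 %| P^`().
      case/dvdpP: jP => C ->; rewrite derivM dvdp_add //.
        by rewrite dvdp_mull // dvdp_exp2l // leq_pred.
      by rewrite dvdp_mull // deriv_exp derivXsubC mul1r -mulr_natr dvdp_mulr.
    by apply: dvdp_sub; apply: dvdp_mulr.
  have qW : (q ^ j.-1 <= 4 * D ^ 2 * h ^ 2)%N.
    have := lead_coef_wronskian_bound (ltn0Sn _) sA sB Ah Bh.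
    rewrite -/W => Wb; apply: (@leq_trans `|lead_coef W|%N); last by rewrite -lez_nat abszE.
    move: dvdW; rewrite dvdzE abszX; apply: dvdn_leq.
    by rewrite absz_gt0 lead_coef_eq0.
  rewrite -(leq_exp2l _ _ q_gt1) mulnC expnM.
  have := leq_trans qW (wronskian_bound T8 (ltn0Sn _) hb).
  rewrite -(leq_exp2r _ _ (isT : (0 < 4)%N)) => /leq_trans-> //.
  rewrite -!expnM; apply: (@leq_trans ((T ^ (160 * d)) ^ s)); last first.
    by rewrite leq_exp2r //; apply: leq_trans s5.
  rewrite -expnM; apply: leq_pexp2l; first by apply: leq_trans T8.
  by rewrite -?(mulnA D); exact: exponent_size.
(* The constant of [taylor_vanishing_bound] for G below, whose coefficients are at most hT since 1 +
   |xi| <= T. *)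
pose U := (D * (D * (h * T * 2 ^ D * 2 ^ D) * T ^ D))%N.
have Uq : (2 * U <= q ^ s)%N.
  apply: leq_trans (taylor_bound T8 (ltn0Sn _) hb) _.
  apply: (@leq_trans ((T ^ (160 * d)) ^ s)); last first.
    by rewrite leq_exp2r //; apply: leq_trans s5.
  rewrite -!expnM; apply: leq_pexp2l; first by apply: leq_trans T8.
  exact: exponent_size.
pose toR := map_poly intr : {poly int} -> {poly R}.
have coefR (p : {poly int}) i : (forall l, `|p`_l| <= h%:Z) -> `|(toR p)`_i| <= h%:R.
  move=> ph; rewrite coef_map /= -intr_norm (_ : h%:R = h%:Z%:~R) //.
  by rewrite ler_int.
have sizeR (p : {poly int}) : size (toR p) = size p.
  by rewrite size_map_inj_poly //; exact: intr_inj.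
have T_ge1 : 1 <= T%:R :> R by rewrite ler1n; apply: leq_trans T8.
have xi_le : `|xi| <= T%:R by apply: le_trans xiT; rewrite lerDr.
pose G := toR A - xi *: toR B.
have sG : (size G <= D)%N.
  apply: leq_trans (size_polyD _ _) _; rewrite size_polyN geq_max sizeR sA /=.
  by apply: leq_trans (size_scale_leq _ _) _; rewrite sizeR.
have Gh i : `|G`_i| <= (h * T)%:R.
  rewrite coefB coefZ; apply: le_trans (ler_normB _ _) _; rewrite normrM natrM.
  have hA := coefR A i Ah; have hB := coefR B i Bh.
  apply: (@le_trans _ _ (h%:R * (1 + `|xi|))); last by rewrite ler_wpM2l.
  by rewrite mulrDr mulr1 lerD // mulrC ler_wpM2r.
have Gxi i : (i < 4 * s)%N -> G^`N(i).[xi] = 0.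
  move=> /AB[S ES]; rewrite nderivnB nderivnZ !nderivn_map hornerD hornerN hornerZ.
  have : (toR (A^`N(i) - 'X * B^`N(i))).[xi] = 0.
    by rewrite ES /toR rmorphM /= hornerM fxi mulr0.
  by rewrite /toR rmorphB rmorphM /= map_polyX hornerD hornerN hornerM hornerX.
have inv_le1 (n : nat) : (0 < n)%N -> (n ^ d.-1)%:R^-1 <= 1 :> R.
  by move=> n0; rewrite invf_le1 ?ler1n ?ltr0n expn_gt0 n0.
have t_xi1 : `|ratr t - xi| <= 1 by apply: le_trans t_xi (inv_le1 _ q_gt0).
have t_le : `|ratr t| <= T%:R :> R.
  apply: le_trans xiT; rewrite -[X in `|X|](subrK xi).
  by apply: le_trans (ler_normD _ _) _; rewrite lerD2r.
have GU := taylor_vanishing_bound j sG Gh T_ge1 xi_le t_xi1 Gxi.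
have sRB : (size (toR B) <= D)%N by rewrite sizeR.
have BU : `|(toR B)^`N(j).[ratr t]| <= U%:R.
  apply: le_trans (horner_bound (size_nderivn_leq j sRB)
    (coef_nderivn_bound j sRB (fun i => coefR B i Bh)) T_ge1 t_le) _.
  rewrite -!natrX -!natrM ler_nat.
  have -> : U = (D * (h * 2 ^ D) * T ^ D * (D * T * 2 ^ D))%N by rewrite /U; ring.
  by rewrite leq_pmulr // !muln_gt0 expn_gt0 (leq_trans _ T8).
have EU : D%:R * (D%:R * ((h * T)%:R * 2 ^+ D * 2 ^+ D) * T%:R ^+ D) = U%:R :> R.
  by rewrite /U !natrM !natrX.
rewrite EU in GU.
(* The first term is small because G vanishes to order 4s at xi, the second because t' is close to
   xi. *)
have EP : ratr P^`N(j).[t] = G^`N(j).[ratr t] + (xi - ratr t') * (toR B)^`N(j).[ratr t].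
  rewrite /P /G !(nderivnB, nderivnZ) !nderivn_map !(hornerD, hornerN, hornerZ).
  rewrite rmorphB rmorphM /= !ratr_horner_int; ring.
(* Clearing denominators, q^(3ds) for t and q' for t', yields a nonzero integer. *)
have low : 1 <= (q ^ (3 * d * s) * q')%:R * `|ratr P^`N(j).[t]| :> R.
  have [n1 E1] := @horner_denq_int A^`N(j) t (3 * d * s) (size_nderivn_leq j sA).
  have [n2 E2] := @horner_denq_int B^`N(j) t (3 * d * s) (size_nderivn_leq j sB).
  pose n := n1 * denq t' - numq t' * n2.
  have En : P^`N(j).[t] * ((denq t)%:~R ^+ (3 * d * s) * (denq t')%:~R) = n%:~R.
    rewrite /P nderivnB nderivnZ !nderivn_map hornerD hornerN hornerZ.
    rewrite /n rmorphB !rmorphM /= -E1 -E2 numqE; ring.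
  have n0 : n != 0.
    rewrite -(intr_eq0 rat) -En !mulf_neq0 ?expf_neq0 ?intr_eq0 ?denq_eq0 //.
  have Eq (x : rat) : (denq x)%:~R = `|denq x|%N%:R :> R by rewrite -absz_denq.
  have := congr1 (fun x : rat => `|ratr x : R|) En; rewrite rmorphM rmorphM rmorphXn /=.
  rewrite !ratr_int !Eq -/q -/q' normrM [X in _ * X = _]ger0_norm ?mulr_ge0 ?exprn_ge0 //.
  rewrite natrM natrX mulrC => ->; rewrite -intr_norm (_ : 1 = 1%:~R) // ler_int.
  by rewrite -gtz0_ge1 normr_gt0.
have q0R : 0 < q%:R :> R by rewrite ltr0n.
have q'0R : 0 < q'%:R :> R by rewrite ltr0n.
pose K := (d.-1 * (4 * s - j))%N.
have b1 : `|G^`N(j).[ratr t]| <= (q ^ K)%:R^-1 * U%:R.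
  apply: le_trans GU _; rewrite ler_wpM2r // /K expnM natrX -exprVn.
  by apply: lerXn2r => //; rewrite nnegrE ?invr_ge0.
have b2 : `|(xi - ratr t') * (toR B)^`N(j).[ratr t]| <= (q' ^ d.-1)%:R^-1 * U%:R.
  by rewrite normrM ler_pM // distrC.
have up : 1 <= (q ^ (3 * d * s) * q')%:R * ((q ^ K)%:R^-1 * U%:R + (q' ^ d.-1)%:R^-1 * U%:R) :> R.
  apply: le_trans low _; rewrite ler_wpM2l // EP.
  by apply: le_trans (ler_normD _ _) _; rewrite lerD.
(* Uses q' < q^(4s+4) and 2U <= q^s. *)
have lt1 : (2 * (q ^ (3 * d * s) * q' * U) < q ^ K)%N.
  apply: (@leq_trans (q ^ (3 * d * s) * q ^ (4 * s.+1) * q ^ s)).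
    rewrite mulnC -mulnA [(U * 2)%N]mulnC; apply: (@leq_trans (q ^ (3 * d * s) * q' * q ^ s).+1).
      by rewrite ltnS leq_mul2l Uq orbT.
    by rewrite ltn_mul2r expn_gt0 q_gt0 ltn_mul2l expn_gt0 q_gt0.
  by rewrite -!expnD; apply: leq_pexp2l => //; exact: exponent_first.
(* One factor q' cancels; the remaining d - 2 are bounded below by q^(4s). *)
have lt2 : (2 * (q ^ (3 * d * s) * q' * U) < q' ^ d.-1)%N.
  have -> : (d.-1 = (d - 2).+1)%N by clear -d25; lia.
  have -> : (2 * (q ^ (3 * d * s) * q' * U) = q' * (q ^ (3 * d * s) * (2 * U)))%N.
    by move: (q ^ _)%N => u; clear; ring.
  rewrite expnS ltn_mul2l q'_gt0 /=.
  apply: (@leq_ltn_trans (q ^ (3 * d * s) * q ^ s)).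
    by rewrite leq_mul2l Uq orbT.
  apply: (@leq_trans ((q ^ (4 * s)) ^ (d - 2))); last first.
    by rewrite leq_exp2r // subn_gt0 (leq_trans _ d25).
  by rewrite -expnD -expnM ltn_exp2l // exponent_second.
have f1 : (q ^ (3 * d * s) * q' * U)%:R / (q ^ K)%:R < 2^-1 :> R.
  rewrite ltr_pdivrMr ?ltr0n ?expn_gt0 ?q_gt0 // mulrC ltr_pdivlMr //.
  by rewrite -natrM ltr_nat mulnC.
have f2 : (q ^ (3 * d * s) * q' * U)%:R / (q' ^ d.-1)%:R < 2^-1 :> R.
  rewrite ltr_pdivrMr ?ltr0n ?expn_gt0 ?q'_gt0 // mulrC ltr_pdivlMr //.
  by rewrite -natrM ltr_nat mulnC.
move: f1 f2 up; rewrite (natrM _ _ U); set x := (q ^ _ * q')%:R; set y := (_ ^ K)%:R^-1.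
set z := (_ ^ d.-1)%:R^-1; set u := U%:R; rewrite mulrDr ![_ * (_ * u)]mulrA.
rewrite ![x * u * _]mulrAC => f1 f2 up.
by have := le_lt_trans up (ltrD f1 f2); rewrite -[2^-1]mul1r -splitr ltxx.
Qed.

(** * The polynomial f *)

(** The value at (X, 1) of the binary form of degree d = 2m + 1 on the left of the equation. *)
Definition thue_poly (a : int) (m : nat) : {poly int} :=
  ('X - a%:P) * ('X^2 + 1) ^+ m - 1.

(** What remains of f' after removing (X^2 + 1)^(m-1): the quadratic (2m+1) X^2 - 2maX + 1. *)
Definition deriv_cofactor (R : comNzRingType) (a : int) (m : nat) : {poly R} :=
  'X^2 + 1 + ('X - (a%:~R)%:P) * 'X *+ (2 * m).

Section ThuePoly.
Variables (a : int) (m : nat).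
Let f := thue_poly a m.

Lemma X2add1_monic : 'X^2 + 1 \is @monic int /\ size ('X^2 + 1 : {poly int}) = 3%N.
Proof using.
have s3 : size ('X^2 + 1 : {poly int}) = 3%N.
  by rewrite size_polyDl ?size_polyXn ?size_poly1.
by split=> //; rewrite monicE lead_coefE s3 coefD coefXn coef1.
Qed.

Lemma thue_poly_shape : f \is monic /\ size f = (2 * m + 1).+1.
Proof using.
have [mon s3] := X2add1_monic.
have monp : ('X - a%:P) * ('X^2 + 1) ^+ m \is monic.
  by rewrite monicMl ?monicXsubC // monic_exp.
have sp : size (('X - a%:P) * ('X^2 + 1) ^+ m) = (2 * m + 1).+1.
  rewrite size_Mmonic ?polyXsubC_eq0 ?monic_exp // size_XsubC.
  have := size_exp ('X^2 + 1 : {poly int}) m; rewrite s3 /=.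
  have : (0 < size (('X^2 + 1 : {poly int}) ^+ m)%R)%N.
    by rewrite size_poly_gt0 monic_neq0 // monic_exp.
  move: (size _) => z; lia.
have lt1 : (size (-1 : {poly int})%R < size (('X - a%:P) * ('X^2 + 1) ^+ m)%R)%N.
  by rewrite size_polyN size_poly1 sp addn1.
split; last by rewrite /f /thue_poly size_polyDl.
by rewrite monicE lead_coefDl // -monicE.
Qed.

Lemma thue_poly_coef i : `|f`_i| <= (`|a| + 1) * 2 ^+ m + 1.
Proof using.
have bin j : `|(('X^2 + 1 : {poly int}) ^+ m)`_j| <= 2 ^+ m.
  elim: m j => [|k IH] j; first by rewrite expr0 coef1; case: eqP.
  rewrite exprS mulrDl mul1r coefD coefXnM [2 ^+ _]exprS.
  apply: le_trans (ler_normD _ _) _; rewrite mulr_natl mulr2n lerD //.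
  by case: ifP => // _; rewrite normr0 exprn_ge0.
rewrite /f /thue_poly coefB mulrBl coefB mul_polyC coefZ coefXM coef1.
apply: le_trans (ler_normB _ _) _; apply: lerD; last by case: eqP.
apply: le_trans (ler_normB _ _) _; rewrite normrM mulrDl mul1r addrC.
apply: lerD; first by rewrite ler_wpM2l.
by case: ifP => // _; rewrite normr0 exprn_ge0.
Qed.

Section Eval.
Variable R : comNzRingType.
Let fR : {poly R} := map_poly intr f.

Lemma map_thue_poly : fR = ('X - (a%:~R)%:P) * ('X^2 + 1) ^+ m - 1.
Proof using.
rewrite /fR /f /thue_poly rmorphB rmorphM /= map_polyXsubC rmorphXn rmorphD /=.
by rewrite !rmorph1 map_polyXn.
Qed.

Lemma thue_poly_horner x : fR.[x] = (x - a%:~R) * (x ^+ 2 + 1) ^+ m - 1.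
Proof using.
by rewrite map_thue_poly !(hornerE, horner_exp).
Qed.

Lemma thue_poly_deriv : (0 < m)%N ->
  fR^`() = ('X^2 + 1) ^+ m.-1 * deriv_cofactor R a m.
Proof using.
move=> m_gt0; rewrite map_thue_poly /deriv_cofactor derivB derivM derivXsubC.
rewrite deriv_exp derivD derivXn -polyC1 !derivC expr1 addr0 subr0 mul1r polyC1.
have -> : ('X^2 + 1 : {poly R}) ^+ m = ('X^2 + 1) * ('X^2 + 1) ^+ m.-1.
  by rewrite -exprS prednK.
ring.
Qed.
End Eval.

Hypotheses (m_gt0 : (0 < m)%N) (a_large : 4 ^+ m * 1024 <= `|a|).

Lemma a_large_m : (2 * m + 1000)%N%:Z <= `|a|.
Proof using m_gt0 a_large.
apply: le_trans a_large; have : (m <= 4 ^ m)%N by apply/ltnW/ltn_expl.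
by rewrite -[4 ^+ m]natrX natz; move: (4 ^ m)%N => z; lia.
Qed.

Section Real.
Variable R : realFieldType.
Let fR : {poly R} := map_poly intr f.
Let N : R := `|a%:~R|.

Lemma a_large_real : 2 * m%:R + 1000 <= N.
Proof using m_gt0 a_large.
have := a_large_m; rewrite -(ler_int R) intr_norm => h; apply: le_trans h.
by rewrite -pmulrn natrD natrM.
Qed.

Lemma norm_near_a (x : R) : `|x - a%:~R| <= 1 -> N - 1 <= `|x| <= N + 1.
Proof using m_gt0 a_large.
move=> xa.
have := ler_dist_dist x a%:~R; rewrite -/N ler_norml => /andP[h1 h2].
by apply/andP; split; lra.
Qed.

(** At a root, x - a is the inverse of (x^2 + 1)^m, which exceeds 1 because x is nonzero. The strict
    bounds serve to exclude integer roots. *)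
Lemma thue_poly_root_close (x : R) : fR.[x] = 0 -> 0 < x - a%:~R < 1.
Proof using m_gt0 a_large.
rewrite thue_poly_horner => /eqP; rewrite subr_eq0 => /eqP E.
have x1 : 1 <= x ^+ 2 + 1 by rewrite lerDr sqr_ge0.
have p1 : 1 <= (x ^+ 2 + 1) ^+ m by apply: exprn_ege1.
have p0 : 0 < (x ^+ 2 + 1) ^+ m by apply: lt_le_trans p1.
have xa0 : 0 < x - a%:~R by rewrite -(pmulr_lgt0 _ p0) E.
rewrite xa0 /=; have xa1 : x - a%:~R <= 1 by nra.
have /norm_near_a/andP[xN _] : `|x - a%:~R| <= 1 by rewrite ger0_norm // ltW.
have x0 : 0 < x ^+ 2.
  have := a_large_real; have := ler0n R m => m0 aR.
  have : 0 < `|x| by lra.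
  by rewrite normr_gt0 => ?; rewrite exprn_even_gt0.
have p2 : 1 < (x ^+ 2 + 1) ^+ m by rewrite exprn_egt1 -?lt0n // ltrDr.
by nra.
Qed.

(** The term c^2 dominates 2m|c| because |a| >= 2m + 1000. The bound is twice N + 2, which in turn
    bounds |t + 1| for t within 1 of a. *)
Lemma deriv_cofactor_large (c : R) : `|c - a%:~R| <= 1 ->
  2 * (N + 2) <= (deriv_cofactor R a m).[c].
Proof using m_gt0 a_large.
move=> ca; have /andP[cN _] := norm_near_a ca; have aR := a_large_real.
have -> : (deriv_cofactor R a m).[c] = c * c + 1 + (c - a%:~R) * c * (2 * m%:R).
  transitivity (c ^+ 2 + 1 + (c - a%:~R) * c *+ (2 * m)); last by ring.
  by rewrite /deriv_cofactor !(hornerE, hornerMn).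
have h : - `|c| <= (c - a%:~R) * c.
  have : `|(c - a%:~R) * c| <= `|c| by rewrite normrM ler_piMl.
  by rewrite ler_norml => /andP[].
have c2 : c * c = `|c| * `|c| by rewrite -normrM ger0_norm // -expr2 sqr_ge0.
rewrite c2.
move: h aR cN; move: ((c - a%:~R) * c) `|c| (m%:R : R) (ler0n R m) => u v k k0 h aR cN.
have h1 : 0 <= k * (u + v) by apply: mulr_ge0 => //; lra.
have h2 : 0 <= v * (v - 2 * k - 999) by apply: mulr_ge0; lra.
by nra.
Qed.

Lemma thue_poly_deriv_large (c : R) : `|c - a%:~R| <= 1 ->
  2 * (N + 2) <= `|fR^`().[c]|.
Proof using m_gt0 a_large.
move=> ca; have q2 := deriv_cofactor_large ca.
have -> : fR^`().[c] = (c ^+ 2 + 1) ^+ m.-1 * (deriv_cofactor R a m).[c].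
  by rewrite thue_poly_deriv // hornerM horner_exp hornerD hornerXn -polyC1 hornerC.
have N0 : 0 <= N by exact: normr_ge0.
have q0 : 0 <= (deriv_cofactor R a m).[c] by apply: le_trans q2; lra.
have e1 : 1 <= (c ^+ 2 + 1) ^+ m.-1 by apply: exprn_ege1; rewrite lerDr sqr_ge0.
rewrite ger0_norm; last by rewrite mulr_ge0 // (le_trans ler01 e1).
by apply: le_trans q2 _; rewrite ler_peMl.
Qed.
End Real.

(** As f is monic, a rational root would be an integer strictly between a and a + 1. *)
Lemma thue_poly_no_rat_root (c : rat) : ~~ root (map_poly intr f) c.
Proof using m_gt0 a_large.
apply/negP => rc.
have : (denq c ^+ 1 %| lead_coef f)%Z.
  by apply: denq_exp_dvd_lead; rewrite expr1 dvdp_XsubCl.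
have [/monicP -> _] := thue_poly_shape; rewrite expr1 dvdz1 => /eqP d1.
have {}d1 : denq c = 1 by have := denq_gt0 c; lia.
have Ec : c = (numq c)%:~R by rewrite numqE d1 mulr1.
have /thue_poly_root_close : (map_poly intr f).[c] = 0 by apply/eqP.
by rewrite Ec -rmorphB /= ltr0z ltrz1; lia.
Qed.

(** Modulo X^2 + 1, f is -1. The other factor of f' splits over the reals, and it is positive within
    distance 1 of a, where all real roots of f lie. *)
Lemma thue_poly_coprime_real (R : rcfType) :
  coprimep (map_poly intr f : {poly R}) (map_poly intr f)^`().
Proof using m_gt0 a_large.
rewrite thue_poly_deriv // coprimepMr; apply/andP; split.
  apply: coprimep_expr; apply/Bezout_coprimepP.
  exists (-1, ('X - (a%:~R)%:P) * ('X^2 + 1) ^+ m.-1) => /=.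
  rewrite map_thue_poly -mulrA -exprSr prednK // mulN1r opprB subrK; exact: eqpxx.
pose A : R := a%:~R; pose M : R := 2 * m%:R + 1.
(* A quarter of the discriminant of the quadratic cofactor. *)
pose de : R := (m%:R * A) ^+ 2 - M.
have aR := a_large_real R.
have M0 : M != 0 by rewrite /M gt_eqF //; have := ler0n R m; lra.
have de0 : 0 <= de.
  have A2 : A ^+ 2 = `|A| ^+ 2 by rewrite -normrX ger0_norm ?sqr_ge0.
  have m1 : 1 <= m%:R :> R by rewrite ler1n.
  rewrite /de exprMn A2 /M; rewrite -/A in aR; move: `|A| aR => u aR.
  have u2 : (2 * m%:R + 1000) * (2 * m%:R + 1000) <= u ^+ 2.
    by rewrite expr2; apply: ler_pM => //; lra.
  move: m1 u2 {aR de M M0 A2}; move: (u ^+ 2) (m%:R : R) => z k m1 u2; nra.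
pose r1 := (m%:R * A + Num.sqrt de) / M; pose r2 := (m%:R * A - Num.sqrt de) / M.
have e1 : M * (r1 + r2) = 2 * m%:R * A by rewrite /r1 /r2; field.
have e2 : M * (r1 * r2) = 1.
  have -> : M * (r1 * r2) = ((m%:R * A) ^+ 2 - (Num.sqrt de) ^+ 2) / M by rewrite /r1 /r2; field.
  by rewrite sqr_sqrtr // /de opprB addrC subrK divff.
have EQ : deriv_cofactor R a m = M *: (('X - r1%:P) * ('X - r2%:P)).
  transitivity (M%:P * 'X^2 - (M * (r1 + r2))%:P * 'X + (M * (r1 * r2))%:P); last first.
    by rewrite -mul_polyC !(polyCM, polyCD); ring.
  rewrite e1 e2 /deriv_cofactor /M -/A !(polyCM, polyCD) polyC1 !polyC_natr; ring.
have Mr (r : R) : M * (('X - r1%:P) * ('X - r2%:P)).[r] = (deriv_cofactor R a m).[r].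
  by rewrite EQ hornerZ.
have nr (r : R) : (r == r1) || (r == r2) -> ~~ root (map_poly intr f) r.
  move=> rr; apply/negP => /eqP /thue_poly_root_close /andP[ra0 ra1].
  have ra : `|r - a%:~R| <= 1 by rewrite ger0_norm ?ltW.
  have := deriv_cofactor_large ra; rewrite -Mr hornerM !hornerXsubC.
  have -> : (r - r1) * (r - r2) = 0.
    by case/orP: rr => /eqP ->; rewrite subrr ?mul0r ?mulr0.
  by rewrite mulr0; have := normr_ge0 (a%:~R : R); lra.
by rewrite EQ coprimepZr // coprimepMr !coprimep_XsubC !nr ?eqxx ?orbT.
Qed.

Lemma thue_poly_coprime :
  coprimep (map_poly intr f : {poly rat}) (map_poly intr f)^`().
Proof using m_gt0 a_large.
rewrite -(coprimep_map (ratr : {rmorphism rat -> realalg})) -deriv_map.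
have -> : map_poly ratr (map_poly intr f) = map_poly intr f :> {poly realalg}.
  by apply/polyP => i; rewrite !coef_map /= ratr_int.
exact: thue_poly_coprime_real.
Qed.

Lemma thue_poly_real_root (R : rcfType) :
  exists2 xi : R, (map_poly intr f).[xi] = 0 & `|xi - a%:~R| <= 1.
Proof using m_gt0 a_large.
pose fR : {poly R} := map_poly intr f.
have h : fR.[a%:~R] <= 0 <= fR.[a%:~R + 1].
  rewrite !thue_poly_horner subrr mul0r sub0r lerN10 /=.
  by rewrite addrAC subrr add0r mul1r subr_ge0 exprn_ege1 // lerDr sqr_ge0.
have [|xi /andP[x1 x2] /eqP rx] := Num.Theory.poly_ivt _ h; first by rewrite lerDl.
by exists xi => //; rewrite ger0_norm ?subr_ge0 //; lra.
Qed.
End ThuePoly.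

(** * Solutions as rational approximations *)

Section Solutions.
Variables (a : int) (m : nat).
Hypotheses (m_gt0 : (0 < m)%N) (a_large : 4 ^+ m * 1024 <= `|a|).

Definition is_solution (p : int * int) : Prop :=
  (p.1 - a * p.2) * (p.1 ^+ 2 + p.2 ^+ 2) ^+ m - p.2 ^+ (2 * m + 1) = p.1 + p.2.

Lemma solution_gap (x y : int) : is_solution (x, y) -> y != 0 -> x != a * y ->
  `|x - a * y| * `|a| ^+ (2 * m - 1) <= `|y|.
Proof using m_gt0 a_large.
rewrite /is_solution /= => E y0 xay.
have N1000 : 1000 <= `|a| by have := a_large_m m_gt0 a_large; lia.
have Z1 : 1 <= `|x - a * y| by move: xay; rewrite -subr_eq0; lia.
have NYXZ : `|a| * `|y| <= `|x| + `|x - a * y|.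
  rewrite -normrM; have := ler_normB x (x - a * y).
  by rewrite opprB addrC subrK.
have Y1 : 1 <= `|y| by lia.
have ES : x ^+ 2 + y ^+ 2 = `|x| ^+ 2 + `|y| ^+ 2 by rewrite -!normrX !ger0_norm ?sqr_ge0.
have H0 : `|x - a * y| * (`|x| ^+ 2 + `|y| ^+ 2) ^+ m <= `|y| ^+ (2 * m + 1) + (`|x| + `|y|).
  rewrite -ES; have S0 : 0 <= x ^+ 2 + y ^+ 2 by rewrite addr_ge0 ?sqr_ge0.
  rewrite -[(_ + _) ^+ m]ger0_norm ?exprn_ge0 // -normrM -normrX.
  have -> : (x - a * y) * (x ^+ 2 + y ^+ 2) ^+ m = y ^+ (2 * m + 1) + (x + y) by rewrite -E; ring.
  by apply: le_trans (ler_normD _ _) _; rewrite lerD2l ler_normD.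
move: N1000 Z1 NYXZ Y1 H0 a_large (normr_ge0 x).
move: `|a| `|x| `|y| `|x - a * y| => N X Y Z {E y0 xay ES} N1000 Z1 NYXZ Y1 H0 aN X0.
set S := X ^+ 2 + Y ^+ 2 in H0.
have S1 : 1 <= S by rewrite /S !expr2; nia.
have SSm : S <= S ^+ m by rewrite -{1}(expr1 S) ler_weXn2l.
have YS : Y ^+ (2 * m + 1) <= Y * S ^+ m.
  rewrite addn1 exprS exprM; apply: ler_wpM2l; first by lia.
  apply: lerXn2r; rewrite ?nnegrE ?sqr_ge0 //; first by lia.
  by rewrite /S lerDr sqr_ge0.
have X2 : X <= X ^+ 2 by rewrite expr2; nia.
have X2S : X ^+ 2 <= S by rewrite /S lerDl sqr_ge0.
(* A crude first bound. It makes |x| comparable to |a y|, after which the right-hand side x + y of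
   the equation costs at most a factor 2. *)
have Z3 : Z <= 3 * Y.
  have Sm0 : 0 < S ^+ m by lia.
  rewrite -(ler_pM2r Sm0); apply: le_trans H0 _.
  by move: (S ^+ m) Sm0 SSm YS => u *; nia.
have X997 : 997 * Y <= X by nia.
have NX : N * Y <= 2 * X by nia.
have XY : 2 * (X + Y) <= S ^+ m.
  apply: le_trans SSm; apply: le_trans X2S; rewrite expr2; nia.
have ZS : Z * S ^+ m <= 2 * Y ^+ (2 * m + 1).
  have : S ^+ m <= Z * S ^+ m by rewrite ler_peMl //; lia.
  by move: (Z * S ^+ m) H0 => u *; lia.
have NYm : (N * Y) ^+ (2 * m) <= 4 ^+ m * S ^+ m.
  rewrite -exprMn exprM; apply: lerXn2r; rewrite ?nnegrE ?sqr_ge0 //.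
    by rewrite mulr_ge0 //; lia.
  apply: (@le_trans _ _ ((2 * X) ^+ 2)).
    by apply: lerXn2r; rewrite ?nnegrE ?mulr_ge0 //; lia.
  by rewrite exprMn /S; have := sqr_ge0 Y; lia.
have Ym0 : 0 < Y ^+ (2 * m) by rewrite exprn_gt0 //; lia.
have N0 : 0 < N by lia.
(* From Z (NY)^(2m) <= 2 4^m Y^(2m+1) and 2 4^m <= N. *)
have ZN : Z * N ^+ (2 * m) <= N * Y.
  rewrite -(ler_pM2r Ym0) -mulrA -exprMn.
  apply: (@le_trans _ _ (Z * (4 ^+ m * S ^+ m))); first by rewrite ler_wpM2l //; lia.
  rewrite mulrCA; apply: (@le_trans _ _ (4 ^+ m * (2 * Y ^+ (2 * m + 1)))).
    by rewrite ler_wpM2l // exprn_ge0.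
  have -> : 4 ^+ m * (2 * Y ^+ (2 * m + 1)) = 2 * 4 ^+ m * Y * Y ^+ (2 * m).
    by rewrite addn1 exprS; ring.
  rewrite ler_wpM2r ?(ltW Ym0) // ler_wpM2r //; first by lia.
  have : 0 <= 4 ^+ m :> int by rewrite exprn_ge0.
  by move: (4 ^+ m) aN => u *; lia.
rewrite -(ler_pM2l N0) mulrCA -exprS.
by have -> : (2 * m - 1).+1 = (2 * m)%N by lia.
Qed.

Lemma fraction_crossE (x y : int) (t : rat) : y != 0 -> t = x%:~R / y%:~R ->
  numq t * y = x * denq t.
Proof using.
move=> y0 Et; apply/eqP; rewrite -(eqr_int rat) !rmorphM /= numqE {1}Et mulrAC.
by rewrite divfK ?intr_eq0 // mulrC.
Qed.

(** For t = p/q in lowest terms, (p - aq) y = (x - ay) q with p - aq a nonzero integer, so |y| <= |x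
    - ay| q; compare with [solution_gap]. *)
Lemma solution_denq (x y : int) (t := x%:~R / y%:~R : rat) :
  is_solution (x, y) -> y != 0 -> x != a * y ->
  (`|a| ^ (2 * m - 1) <= `|denq t|)%N /\ (`|denq t| <= `|y|)%N.
Proof using m_gt0 a_large.
move=> sol y0 xay; have cross := fraction_crossE y0 (erefl t); split.
  have gap := solution_gap sol y0 xay.
  have Ez : (numq t - a * denq t) * y = (x - a * y) * denq t.
    by rewrite mulrBl cross; ring.
  have n0 : numq t - a * denq t != 0.
    have : (x - a * y) * denq t != 0 by rewrite mulf_neq0 ?denq_eq0 ?subr_eq0.
    by rewrite -Ez mulf_eq0 negb_or => /andP[].
  have Z0 : 0 < `|x - a * y| by rewrite normr_gt0 subr_eq0.
  have E' := congr1 (fun u => `|u|) Ez; rewrite /= !normrM in E'.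
  rewrite -lez_nat -abszX !abszE normrX -(ler_pM2l Z0) -E'; apply: le_trans gap _.
  by rewrite ler_peMl //; lia.
apply: dvdn_leq; first by rewrite absz_gt0.
have : (`|denq t| %| `|numq t| * `|y|)%N by rewrite -abszM cross abszM dvdn_mull.
by rewrite Gauss_dvdr // coprime_sym coprime_num_den.
Qed.

Section Approximation.
Variables (R : rcfType) (xi : R).
Hypotheses (xi_root : (map_poly intr (thue_poly a m)).[xi] = 0)
  (xi_close : `|xi - a%:~R| <= 1).

(** The equation divided by y, by homogeneity of its left-hand side. *)
Lemma solution_horner (F : numFieldType) (x y : int) (t := x%:~R / y%:~R : F) :
  is_solution (x, y) -> y != 0 ->
  (map_poly intr (thue_poly a m)).[t] * y%:~R ^+ (2 * m) = t + 1.
Proof using.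
rewrite /is_solution /= => E y0.
have y0F : y%:~R != 0 :> F by rewrite intr_eq0.
have Ex : x%:~R = t * y%:~R by rewrite /t divfK.
set Y : F := y%:~R in y0F Ex *.
have EF : (t * Y - a%:~R * Y) * ((t * Y) ^+ 2 + Y ^+ 2) ^+ m - Y ^+ (2 * m + 1)
    = t * Y + Y.
  rewrite -Ex /Y -!(rmorphXn, rmorphM, rmorphD, rmorphB) /=.
  by rewrite E.
clearbody t; apply: (mulIf y0F); rewrite thue_poly_horner.
have -> : (t + 1) * Y = t * Y + Y by ring.
have e : (t * Y) ^+ 2 + Y ^+ 2 = (t ^+ 2 + 1) * Y ^+ 2 by ring.
rewrite -EF e [(_ * Y ^+ 2) ^+ m]exprMn -exprM addn1 [Y ^+ (2 * m).+1]exprS.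
by move: ((t ^+ 2 + 1) ^+ m) (Y ^+ (2 * m)) => u v; ring.
Qed.

(** Mean value theorem between t and xi: |f'| is at least 2(|a| + 2) there, while |f(t)| |y|^(2m) =
    |t + 1| <= |a| + 2. Finally q <= |y|. *)
Lemma solution_approx (x y : int) (t := x%:~R / y%:~R : rat) :
  is_solution (x, y) -> y != 0 -> x != a * y ->
  `|ratr t - xi| <= (2 * `|denq t| ^ (2 * m))%:R^-1.
Proof using m_gt0 a_large xi_root xi_close.
move=> sol y0 xay; have [_ qY] := solution_denq sol y0 xay.
have y0R : y%:~R != 0 :> R by rewrite intr_eq0.
have Et : ratr t = x%:~R / y%:~R :> R by rewrite /t fmorph_div /= !ratr_int.
have tf := solution_horner R sol y0; rewrite -Et in tf.
have N0 : 0 < `|a| by have := a_large_m m_gt0 a_large; lia.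
have t_close : `|ratr t - a%:~R : R| <= 1.
  have -> : ratr t - a%:~R = (x - a * y)%:~R / y%:~R :> R.
    by rewrite Et rmorphB rmorphM /= mulrBl mulfK.
  rewrite normrM normfV ler_pdivrMr ?normr_gt0 // mul1r -!intr_norm ler_int.
  apply: le_trans (solution_gap sol y0 xay); rewrite ler_peMr //.
  by apply: exprn_ege1; lia.
have xr := xi_root; set fR := map_poly intr _ in tf xr; set tR : R := ratr t in tf t_close *.
have mvt : 2 * (`|a%:~R| + 2) * `|tR - xi| <= `|fR.[tR]|.
  have [lt|lt|eq] := ltgtP tR xi.
  - have [c] := poly_mvt fR lt; rewrite in_itv /= => /andP[c1 c2]; rewrite xr sub0r => Ec.
    rewrite -(normrN fR.[tR]) Ec normrM (distrC xi) ler_wpM2r //.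
    apply: (@thue_poly_deriv_large a m m_gt0 a_large R c).
    by move: t_close xi_close; rewrite !ler_norml => /andP[? ?] /andP[? ?]; apply/andP; split; lra.
  - have [c] := poly_mvt fR lt; rewrite in_itv /= => /andP[c1 c2]; rewrite xr subr0 => Ec.
    rewrite Ec normrM ler_wpM2r //.
    apply: (@thue_poly_deriv_large a m m_gt0 a_large R c).
    by move: t_close xi_close; rewrite !ler_norml => /andP[? ?] /andP[? ?]; apply/andP; split; lra.
  - by rewrite eq subrr normr0 mulr0.
have /andP[_ tN] := norm_near_a m_gt0 a_large t_close.
have tf' : `|fR.[tR]| * `|y|%:~R ^+ (2 * m) <= `|a%:~R| + 2.
  rewrite intr_norm -normrX -normrM tf; apply: le_trans (ler_normD _ _) _.
  by rewrite normr1; lra.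
have Y0 : 0 < `|y|%:~R ^+ (2 * m) :> R by rewrite exprn_gt0 // ltr0z normr_gt0.
have A0 : 0 < `|a%:~R| + 2 :> R by have := normr_ge0 (a%:~R : R); lra.
have key : `|tR - xi| * (2 * `|y|%:~R ^+ (2 * m)) <= 1.
  rewrite -(ler_pM2l A0) mulr1; apply: le_trans tf'.
  apply: le_trans (ler_wpM2r (ltW Y0) mvt).
  by rewrite le_eqVlt; apply/orP; left; apply/eqP; ring.
rewrite -[leRHS]mul1r ler_pdivlMr ?ltr0n ?muln_gt0 ?expn_gt0 ?absz_gt0 ?denq_eq0 //.
apply: le_trans key; rewrite ler_wpM2l // natrM natrX ler_wpM2l //.
apply: lerXn2r; rewrite ?nnegrE ?ler0z //.
by rewrite pmulrn ler_int -abszE lez_nat.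
Qed.
End Approximation.
End Solutions.

(** * The gap principle *)

Lemma rat_distance (t1 t2 : rat) : t1 != t2 ->
  1 <= `|t1 - t2| * (`|denq t1| * `|denq t2|)%N%:R.
Proof.
move=> t12; pose n := numq t1 * denq t2 - numq t2 * denq t1.
have Eq (x : rat) : `|denq x|%N%:R = (denq x)%:~R :> rat by rewrite -[in RHS]absz_denq.
have En : (t1 - t2) * (`|denq t1| * `|denq t2|)%N%:R = n%:~R.
  by rewrite natrM !Eq rmorphB !rmorphM /= !numqE; ring.
have n0 : n != 0.
  rewrite -(intr_eq0 rat) -En mulf_neq0 ?subr_eq0 // pnatr_eq0 muln_eq0.
  by rewrite !absz_eq0 !denq_eq0.
rewrite -[X in _ * X]ger0_norm // -normrM En -intr_norm (_ : 1 = 1%:~R) // ler_int.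
by rewrite -gtz0_ge1 normr_gt0.
Qed.

(** Distinct fractions differ by at least 1/(q1 q2), but these two lie within q1^-(e+1) of each
    other. *)
Lemma approximation_gap (R : realFieldType) (xi : R) (e : nat) (t1 t2 : rat)
    (q1 := `|denq t1|%N) (q2 := `|denq t2|%N) :
  t1 != t2 -> (q1 <= q2)%N ->
  `|ratr t1 - xi| <= (2 * q1 ^ e.+1)%:R^-1 ->
  `|ratr t2 - xi| <= (2 * q2 ^ e.+1)%:R^-1 -> (q1 ^ e <= q2)%N.
Proof.
move=> t12 q12 h1 h2.
have q1_gt0 : (0 < q1)%N by rewrite absz_gt0 denq_eq0.
have q2_gt0 : (0 < q2)%N by rewrite absz_gt0 denq_eq0.
have low : 1 <= `|ratr t1 - ratr t2| * (q1 * q2)%:R :> R.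
  have := rat_distance t12; rewrite -(ler_rat R) rmorph1 rmorphM /= ratr_norm.
  by rewrite rmorphB /= ratr_nat.
have inv1 : 0 < (q1 ^ e.+1)%:R :> R by rewrite ltr0n expn_gt0 q1_gt0.
have up : `|ratr t1 - ratr t2| <= (q1 ^ e.+1)%:R^-1 :> R.
  apply: le_trans (ler_distD xi _ _) _; rewrite [`|xi - _|]distrC.
  apply: le_trans (lerD h1 h2) _.
  have h2' : (2 * q2 ^ e.+1)%:R^-1 <= (2 * q1 ^ e.+1)%:R^-1 :> R.
    rewrite lef_pV2 ?posrE ?ltr0n ?muln_gt0 ?expn_gt0 ?q1_gt0 ?q2_gt0 //.
    by rewrite ler_nat leq_mul2l leq_exp2r.
  apply: le_trans (lerD (lexx _) h2') _.
  rewrite natrM invfM; move: inv1; move: (_ ^ _)%:R => u u0.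
  by have : u^-1 = 2^-1 * u^-1 + 2^-1 * u^-1 by [field; rewrite gt_eqF]; lra.
have := le_trans low (ler_wpM2r (ler0n _ _) up).
rewrite mulrC ler_pdivlMr // mul1r ler_nat expnS leq_pmul2l //.
Qed.

Lemma thue_poly_coef_sq (a : int) (m i : nat) : 4 ^+ m * 1024 <= `|a| ->
  1 + `|(thue_poly a m)`_i| <= (`|a| ^ 2)%N%:Z.
Proof.
move=> a_large; have h := thue_poly_coef a m i; have b24 : 2 ^+ m <= 4 ^+ m :> int.
  by rewrite lerXn2r.
have b0 : 1 <= 2 ^+ m :> int by rewrite exprn_ege1.
rewrite -mulnn PoszM !abszE.
move: a_large b24 b0 h; move: (2 ^+ m) (4 ^+ m) `|a| `|_`_i| => u v N c *; nia.
Qed.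

Section FourApproximations.
Variables (a : int) (m : nat) (R : rcfType) (xi : R).
Hypotheses (m12 : (12 <= m)%N) (a_large : 4 ^+ m * 1024 <= `|a|).
Hypotheses (xi_root : (map_poly intr (thue_poly a m)).[xi] = 0)
  (xi_close : `|xi - a%:~R| <= 1).

Definition approximant (t : rat) : Prop :=
  (`|a| ^ (2 * m - 1) <= `|denq t|)%N /\
  `|ratr t - xi| <= (2 * `|denq t| ^ (2 * m))%:R^-1.

Let m_gt0 : (0 < m)%N. Proof. exact: leq_trans m12. Qed.

Lemma no_four_approximants (t1 t2 t3 t4 : rat) :
  approximant t1 -> approximant t2 -> approximant t3 -> approximant t4 ->
  t1 != t2 -> t2 != t3 -> t3 != t4 ->
  (`|denq t1| <= `|denq t2|)%N -> (`|denq t2| <= `|denq t3|)%N ->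
  (`|denq t3| <= `|denq t4|)%N -> False.
Proof using m12 a_large xi_root xi_close.
move=> [n1 h1] [_ h2] [_ h3] [_ h4] t12 t23 t34 q12 q23 q34.
have N1000 : (1000 <= `|a|)%N by have := a_large_m m_gt0 a_large; lia.
have Em : (2 * m = (2 * m).-1.+1)%N by lia.
(* Here (2m) - 1 = d - 2 is the exponent of the gap principle. *)
have m23 : (23 <= (2 * m).-1)%N by lia.
have gap s s' : s != s' -> (`|denq s| <= `|denq s'|)%N ->
    `|ratr s - xi| <= (2 * `|denq s| ^ (2 * m))%:R^-1 ->
    `|ratr s' - xi| <= (2 * `|denq s'| ^ (2 * m))%:R^-1 ->
    (`|denq s| ^ 23 <= `|denq s'|)%N.
  rewrite Em => ss' qq k1 k2; apply: leq_trans (approximation_gap ss' qq k1 k2).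
  by apply: leq_pexp2l => //; rewrite absz_gt0 denq_eq0.
have g12 := gap _ _ t12 q12 h1 h2; have g23 := gap _ _ t23 q23 h2 h3.
have g34 := gap _ _ t34 q34 h3 h4.
have weaken (t : rat) : `|ratr t - xi| <= (2 * `|denq t| ^ (2 * m))%:R^-1 ->
    `|ratr t - xi| <= (`|denq t| ^ (2 * m + 1).-1)%:R^-1.
  move=> h; apply: le_trans h _; have q0 : (0 < `|denq t|)%N by rewrite absz_gt0 denq_eq0.
  rewrite addn1 /= lef_pV2 ?posrE ?ltr0n ?muln_gt0 ?expn_gt0 ?q0 //.
  by rewrite ler_nat leq_pmull.
have [f_monic sf] := thue_poly_shape a m.
(* T = |a|^2 dominates the coefficients of f and 1 + |xi|. *)
apply: (@thue_pair R (thue_poly a m) (2 * m + 1) (`|a| ^ 2) xi t3 t4) => //.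
- by clear -m12; lia.
- by apply: (@leq_trans (1000 ^ 2)); rewrite // leq_exp2r.
- by move=> i; apply: thue_poly_coef_sq.
- exact: thue_poly_coprime.
- exact: thue_poly_no_rat_root.
- have /andP[_ xN] := norm_near_a m_gt0 a_large xi_close.
  apply: (@le_trans _ _ (`|a|%N%:R + 2)).
    by rewrite natr_absz intr_norm; lra.
  rewrite -natrD ler_nat -mulnn; clear -N1000; nia.
- exact: weaken.
- exact: weaken.
(* Two gaps give q3 >= q1^529 >= |a|^(529(2m-1)), and this exceeds T^(160d) = |a|^(320(2m+1)). *)
- rewrite -expnM; apply: leq_trans g23; apply: (@leq_trans ((`|denq t1| ^ 23) ^ 23)).
    apply: (@leq_trans (((`|a| ^ (2 * m - 1)) ^ 23) ^ 23)).
      by rewrite -!expnM; apply: leq_pexp2l; clear -m12 N1000; lia.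
    by rewrite !leq_exp2r.
  by rewrite leq_exp2r.
Qed.
End FourApproximations.

(** * Counting the solutions *)

Lemma cover_by_list (T : eqType) (A : T -> Prop) (n : nat) :
  (forall s, uniq s -> (forall x, x \in s -> A x) -> (size s <= n)%N) ->
  exists s, (size s <= n)%N /\ forall x, A x -> x \in s.
Proof.
move=> bound.
(* A list of distinct elements of A is extended one by one until it is exhaustive; the bound
   excludes length n + 1. *)
have step k : (exists s, [/\ uniq s, size s = k & forall x, x \in s -> A x]) \/
    exists s, (size s < k)%N /\ forall x, A x -> x \in s.
  elim: k => [|k [[s [us sk sA]]|[s [sk cov]]]]; first by left; exists [::].
    have [[x [Ax xs]]|none] := boolp.pselect (exists x, A x /\ x \notin s).
      left; exists (x :: s); split=> /=; rewrite ?xs ?sk //.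
      by move=> y; rewrite inE => /predU1P[->|/sA].
    right; exists s; split; first by rewrite sk.
    by move=> x Ax; apply: boolp.contrapT => /negP xs; apply: none; exists x.
  by right; exists s; split; [exact: ltnW|].
have [[s [us sn sA]]|[s [sn cov]]] := step n.+1; last by exists s.
by have := bound s us sA; rewrite sn ltnn.
Qed.

Section Counting.
Variables (a : int) (m : nat).
Hypotheses (m12 : (12 <= m)%N) (a_large : 4 ^+ m * 1024 <= `|a|).

Let m_gt0 : (0 < m)%N. Proof. exact: leq_trans m12. Qed.
Let ratio (p : int * int) : rat := p.1%:~R / p.2%:~R.

(** The sign of y is normalised because (x, y) and (-x, -y) are solutions together and have the same
    ratio. *)
Definition ordinary_solution (p : int * int) : Prop :=
  [/\ is_solution a m p, 0 < p.2 & p.1 != a * p.2].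

Lemma even_power_inj (y y' : int) : 0 < y -> 0 < y' ->
  y ^+ (2 * m) = y' ^+ (2 * m) -> y = y'.
Proof using m_gt0.
move=> y0 y'0 /eqP; rewrite eqrXn2 ?(ltW y0) ?(ltW y'0) ?muln_gt0 // => /eqP //.
Qed.

(** Solutions need not be coprime pairs, so the ratio alone does not suffice. But f(t) y^(2m) = t +
    1 determines y > 0 from t once t + 1 is nonzero, and x = -y contradicts [solution_gap]. *)
Lemma ratio_inj p p' : ordinary_solution p -> ordinary_solution p' ->
  ratio p = ratio p' -> p = p'.
Proof using m12 a_large.
case: p p' => [x y] [x' y'] [/= s1 y0 z1] [/= s2 y'0 z2] E.
have yn : y != 0 by rewrite gt_eqF.
have y'n : y' != 0 by rewrite gt_eqF.
have e1 := solution_horner rat s1 yn; have e2 := solution_horner rat s2 y'n.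
rewrite /ratio /= in E.
have t1 : x%:~R / y%:~R + 1 != 0 :> rat.
  apply/eqP => /(congr1 (fun u : rat => u * y%:~R)); rewrite mulrDl divfK ?intr_eq0 //.
  rewrite mul0r mul1r -rmorphD /= => /eqP; rewrite intr_eq0 addr_eq0 => /eqP xy.
  have := solution_gap m_gt0 a_large s1 yn z1; rewrite xy.
  have N1000 : 1000 <= `|a| by have := a_large_m m_gt0 a_large; lia.
  have : 1 <= `|a| ^+ (2 * m - 1) by apply: exprn_ege1; lia.
  move: (_ ^+ _) => u u1.
  have -> : - y - a * y = - ((1 + a) * y) by ring.
  rewrite normrN normrM; have : 2 <= `|1 + a| by lia.
  have : 0 < `|y| by rewrite normr_gt0.
  move: `|1 + a| `|y| => b c c0 b2 h.
  have : c < b * c by nia.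
  have : b * c <= b * c * u by rewrite ler_peMr ?mulr_ge0 //; lia.
  by lia.
have f0 : (map_poly intr (thue_poly a m)).[x%:~R / y%:~R : rat] != 0.
  by apply: contraNneq t1 => h; rewrite -e1 h mul0r.
have Ey : y = y'.
  apply: even_power_inj => //; apply: (@intr_inj rat); rewrite !rmorphXn /=.
  by apply: (mulfI f0); rewrite e1 E e2.
congr (_, _) => //; apply: (@intr_inj rat).
have /(congr1 (fun u : rat => u * y%:~R)) := E.
by rewrite -Ey !divfK ?intr_eq0.
Qed.

Lemma ordinary_solutions_bound (s : seq (int * int)) : uniq s ->
  (forall p, p \in s -> ordinary_solution p) -> (size s <= 3)%N.
Proof using m12 a_large.
move=> us sA; pose r (p p' : int * int) := (`|denq (ratio p)| <= `|denq (ratio p')|)%N.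
have rtot : total r by move=> p p'; exact: leq_total.
rewrite -(size_sort r s); have := sort_sorted rtot s.
have : uniq (sort r s) by rewrite sort_uniq.
have : forall p, p \in sort r s -> ordinary_solution p by move=> p; rewrite mem_sort => /sA.
case: (sort r s) => [|p1 [|p2 [|p3 [|p4 s']]]] //= {us sA s} sA.
rewrite !inE !negb_or => /andP[/and4P[n12 _ _ _] /andP[/and3P[n23 _ _] /andP[/andP[n34 _] _]]].
case/and4P => q12 q23 q34 _; exfalso.
have [xi xr xc] := thue_poly_real_root m_gt0 a_large realalg.
have ord p : p \in [:: p1, p2, p3, p4 & s'] -> approximant a m xi (ratio p).
  move=> /sA [sp p0 pz]; have pn : p.2 != 0 by rewrite gt_eqF.
  case: p sp p0 pz pn => x y sp p0 pz pn; split.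
    exact: (solution_denq m_gt0 a_large sp pn pz).1.
  exact: (solution_approx m_gt0 a_large xr xc sp pn pz).
have neq p p' : p \in [:: p1, p2, p3, p4 & s'] -> p' \in [:: p1, p2, p3, p4 & s'] ->
    p != p' -> ratio p != ratio p'.
  by move=> /sA o /sA o'; apply: contra_neq; exact: ratio_inj.
by apply: (@no_four_approximants a m realalg xi m12 a_large xr xc
  (ratio p1) (ratio p2) (ratio p3) (ratio p4)); rewrite ?neq //; try apply: ord;
  rewrite !inE eqxx ?orbT.
Qed.

Lemma degenerate_solutions_bound (s : seq (int * int)) : uniq s ->
  (forall p, p \in s -> [/\ is_solution a m p, 0 < p.2 & p.1 = a * p.2]) ->
  (size s <= 1)%N.
Proof using m12.
have key (p : int * int) : [/\ is_solution a m p, 0 < p.2 & p.1 = a * p.2] ->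
    p.2 ^+ (2 * m) = - (a + 1).
  case: p => x y [/= ]; rewrite /is_solution /= => E y0 Ex.
  move: E; rewrite Ex subrr mul0r sub0r addn1 exprS => E.
  have yn : y != 0 by rewrite gt_eqF.
  by apply: (mulfI yn); rewrite -[LHS]opprK E; ring.
case: s => [|p [|p' s]] //= /andP[]; rewrite inE negb_or => /andP[pp' _] _ sA.
have hp : p \in [:: p, p' & s] by rewrite inE eqxx.
have hp' : p' \in [:: p, p' & s] by rewrite !inE eqxx orbT.
case/negP: pp'; have [_ y0 x1] := sA p hp; have [_ y'0 x2] := sA p' hp'.
have Ey : p.2 = p'.2.
  by apply: even_power_inj => //; rewrite (key _ (sA p hp)) (key _ (sA p' hp')).
by apply/eqP; case: p p' x1 x2 Ey {hp hp' sA y0 y'0 key} => [x y] [x' y'] /= -> -> ->.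
Qed.

Lemma is_solutionN (x y : int) : is_solution a m (x, y) -> is_solution a m (- x, - y).
Proof using.
have e : (- y) ^+ (2 * m + 1) = - y ^+ (2 * m + 1).
  by rewrite addn1 !(exprS _ (2 * m)) !exprM sqrrN mulNr.
rewrite /is_solution /= !sqrrN e => E.
have -> : - x - a * - y = - (x - a * y) by ring.
have -> : - x + - y = - (x + y) by ring.
by rewrite -E; ring.
Qed.

Lemma is_solution_y0 (x : int) : is_solution a m (x, 0) -> x \in [:: 0; 1; -1].
Proof using m12.
rewrite /is_solution [(x, 0).1]/= [(x, 0).2]/= addn1 !expr0n !(mulr0, subr0, addr0).
rewrite -exprM; have [-> //|x0] := eqVneq x 0.
rewrite -[RHS]mulr1 => /(mulfI x0) /(congr1 (fun u => `|u|)) /eqP.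
rewrite normrX normr1 pexpr_eq1 ?muln_gt0 // !inE => /eqP.
by clear; lia.
Qed.

Lemma solutions_cover :
  exists s, (size s <= 11)%N /\ forall p, is_solution a m p -> p \in s.
Proof using m12 a_large.
have [s3 [s3n cov3]] := cover_by_list ordinary_solutions_bound.
have [s1 [s1n cov1]] := cover_by_list degenerate_solutions_bound.
pose L := s3 ++ s1; pose opp (p : int * int) := (- p.1, - p.2).
have cov p : is_solution a m p -> 0 < p.2 -> p \in L.
  move=> sp p0; rewrite mem_cat; have [e|ne] := eqVneq p.1 (a * p.2).
    by rewrite cov1 ?orbT.
  by rewrite cov3.
(* The count is 3 + 2(3 + 1) = 11: three solutions with y = 0, and up to sign three ordinary ones
   and one with x = ay. *)
exists ([:: (0, 0); (1, 0); (-1, 0)] ++ L ++ map opp L); split.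
  have sL : (size L <= 4)%N by rewrite size_cat; exact: leq_add s3n s1n.
  by rewrite size_cat size_cat size_map; exact: (leq_add (leqnn 3) (leq_add sL sL)).
move=> [x y] sp; rewrite mem_cat (mem_cat _ L); have [y0|y0|y0] := ltgtP y 0.
- apply/orP; right; apply/orP; right; apply/mapP; exists (- x, - y); last by rewrite /opp /= !opprK.
  by apply: cov; [exact: is_solutionN | rewrite /= oppr_gt0].
- by apply/orP; right; apply/orP; left; apply: cov.
- move: sp; rewrite y0 => /is_solution_y0; rewrite !inE.
  by case/or3P => /eqP ->; rewrite eqxx ?orbT.
Qed.
End Counting.

(** * Cardinality of the solution set *)

Local Open Scope classical_set_scope.
Local Open Scope card_scope.
Local Open Scope ring_scope.

Lemma card_le_of_cover (T : eqType) (x0 : T) (A : set T) (s : seq T) (n : nat) :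
  (size s <= n)%N -> (forall x, A x -> x \in s) -> A #<= `I_n.
Proof.
move=> sn cov; apply: card_le_trans (card_image_le (nth x0 s) `I_n).
apply: subset_card_le => x /cov xs; exists (index x s); last exact: nth_index.
by rewrite /=; apply: leq_trans sn; rewrite index_mem.
Qed.

Theorem theorem6p1 (d : nat) (a : int) (hd : (25 <= d)%N) (dodd : odd d)
    (ha : 2 ^+ (164 * d)%N <= `|a|) :
  [set p : int * int |
    (p.1 - a * p.2) * (p.1 ^+ 2 + p.2 ^+ 2) ^+ ((d - 1) %/ 2)%N - p.2 ^+ d
      = p.1 + p.2] #<= `I_11.
Proof.
pose m := ((d - 1) %/ 2)%N.
have Ed : d = (2 * m + 1)%N by rewrite /m; lia.
have m12 : (12 <= m)%N by lia.
(* The left-hand side is 2^(2m+10), and 2m + 10 <= 164d. *)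
have a_large : 4 ^+ m * 1024 <= `|a|.
  apply: le_trans ha; rewrite (_ : 4 = 2 ^+ 2) // (_ : 1024 = 2 ^+ 10) //.
  by rewrite -exprM -exprD ler_weXn2l //; lia.
have [s [sn cov]] := solutions_cover m12 a_large.
apply: (card_le_of_cover (0, 0) sn) => p /= sp; apply: cov.
by rewrite /is_solution -Ed.
Qed.
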